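(* Let $N\ge 2$ and let $\Omega\subset\mathbb{R}^N$ be a bounded domain with Lipschitz boundary $\partial\Omega$. Let $s:\mathbb{R}^N\times\mathbb{R}^N\to(0,1)$ be continuous with $s(x,y)=s(y,x)$ for all $x,y$ and $0<s^-:=\inf s\le s^+:=\sup s<1$. Let $a:\overline\Omega\times\overline\Omega\times(0,+\infty)\to[0,+\infty)$, write $a_{x,y}(t)=a(x,y,t)$, and let $G_{x,y}(t)=G(x,y,t)=\int_0^{|t|}g(x,y,\tau)\,d\tau$ be a Carathéodory function on $\overline\Omega\times\overline\Omega\times\mathbb{R}$, where $g(x,y,t)=a(x,y,t)t$ for $t\neq0$ and $g(x,y,0)=0$. Assume: (1) $\lim_{t\to0}a_{x,y}(t)t=0$ and $\lim_{t\to+\infty}a_{x,y}(t)t=+\infty$ for all $(x,y)\in\overline\Omega\times\overline\Omega$; (2) $t\mapsto a_{x,y}(t)$ is continuous on $(0,+\infty)$ for all $(x,y)\in\overline\Omega\times\overline\Omega$; (3) $t\mapsto a_{x,y}(t)t$ is increasing on $(0,+\infty)$ for all $(x,y)\in\overline\Omega\times\overline\Omega$; (4) there are constants $g^-,g^+$ with $1<g^-\le \dfrac{a_{x,y}(t)t^2}{G_{x,y}(t)}\le g^+<+\infty$ for all $(x,y)\in\overline\Omega\times\overline\Omega$ and all $t>0$; (5) there are constants $C_1,C_2>0$ with $C_1\le G_{x,y}(1)\le C_2$ for all $(x,y)\in\overline\Omega\times\overline\Omega$; (6) there are a constant $M>0$ and a continuous function $p:\overline\Omega\times\overline\Omega\to(1,+\infty)$,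 with $p(x,y)=p(y,x)$, $1<p^-\le p(x,y)\le p^+<+\infty$ for all $(x,y)\in\overline\Omega\times\overline\Omega$, and $s^+p^+<N$, such that $|t|^{p(x,y)}\le M\,G_{x,y}(t)$ for all $(x,y)\in\overline\Omega\times\overline\Omega$ and all $t\ge0$. Let $m:\overline\Omega\to(0,1)$ be continuous, let $r:\overline\Omega\to(1,+\infty)$ be continuous with $1<r(x)<p_s^*(x):=\dfrac{N\,p(x,x)}{N-s(x,x)p(x,x)}$ for all $x\in\overline\Omega$, and let $h:\overline\Omega\to\mathbb{R}$ be a positive continuous function belonging to $L^{\frac{r(x)}{r(x)+m(x)-1}}(\Omega)$. Then the problem $$\begin{cases}(-\Delta)^{s(\cdot,\cdot)}_{G_{x,y}}u(x)+a_{x,x}(|u(x)|)u(x)=\dfrac{h(x)}{u^{m(x)}} & \text{in }\Omega,\\ u>0 & \text{in }\Omega,\\ u=0 & \text{in }\mathbb{R}^N\setminus\Omega\end{cases}$$ has a nontrivial weak solution $u_0\in W^{s(\cdot,\cdot),G_{x,y}}(\Omega)$.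
   Context: Notation. $\widehat a_x(t):=a_{x,x}(t)$, $\widehat G_x(t):=G_{x,x}(t)$, $D_{s(\cdot,\cdot)}u(x,y):=\dfrac{u(x)-u(y)}{|x-y|^{s(x,y)}}$, $d\mu:=\dfrac{dx\,dy}{|x-y|^N}$ on $\Omega\times\Omega$. Expressions $a_{x,y}(|t|)t$ are understood as $0$ when $t=0$. Operator (formal definition): $$(-\Delta)^{s(\cdot,\cdot)}_{G_{x,y}}u(x):=2\lim_{\epsilon\to0^+}\int_{\mathbb{R}^N\setminus B_\epsilon(x)}a_{x,y}\left(\frac{|u(x)-u(y)|}{|x-y|^{s(x,y)}}\right)\frac{u(x)-u(y)}{|x-y|^{s(x,y)}}\frac{dy}{|x-y|^{N+s(x,y)}}.$$ Spaces. With $J_{\widehat G_x}(u):=\int_\Omega\widehat G_x(|u(x)|)\,dx$, the Musielak-Orlicz space is $$L^{\widehat G_x}(\Omega)=\{u:\Omega\to\mathbb{R}\text{ measurable}: J_{\widehat G_x}(\lambda u)<+\infty\text{ for some }\lambda>0\},$$ with norm $\|u\|_{L^{\widehat G_x}(\Omega)}=\inf\{\lambda>0:J_{\widehat G_x}(u/\lambda)\le1\}$. With $J_{s(\cdot,\cdot),G_{x,y}}(u):=\int_\Omega\int_\Omega G_{x,y}(D_{s(\cdot,\cdot)}u)\,d\mu$, the variable order fractional Musielak-Sobolev space is $$W^{s(\cdot,\cdot),G_{x,y}}(\Omega):=\{u\in L^{\widehat G_x}(\Omega):J_{s(\cdot,\cdot),G_{x,y}}(\lambda u)<+\infty\text{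 for some }\lambda>0\},$$ with norm $\|u\|_{W^{s(\cdot,\cdot),G_{x,y}}(\Omega)}=\|u\|_{L^{\widehat G_x}(\Omega)}+\inf\{\lambda>0:J_{s(\cdot,\cdot),G_{x,y}}(u/\lambda)\le1\}$. For a continuous $q:\overline\Omega\to(1,+\infty)$, $L^{q(x)}(\Omega)$ is the variable exponent Lebesgue space of measurable $u$ with $\int_\Omega|u(x)|^{q(x)}dx<+\infty$. Weak solution. A function $u$ is called a weak solution of the problem if $u\in W^{s(\cdot,\cdot),G_{x,y}}(\Omega)$, $u>0$ in $\Omega$, and $$\int_\Omega\int_\Omega a_{x,y}\big(|D_{s(\cdot,\cdot)}u|\big)D_{s(\cdot,\cdot)}u\,D_{s(\cdot,\cdot)}v\,d\mu+\int_\Omega\widehat a_x(|u|)\,u\,v\,dx=\int_\Omega\frac{h(x)}{u^{m(x)}}\,v\,dx$$ for all $v\in W^{s(\cdot,\cdot),G_{x,y}}(\Omega)$. *)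

(* Defs.v *)
From HB Require Import structures.
From mathcomp Require Import all_boot all_order all_algebra.
From mathcomp Require Import all_classical all_reals all_analysis.
From mathcomp Require Import lra.

Set Implicit Arguments.
Unset Strict Implicit.
Unset Printing Implicit Defensive.
Import Order.TTheory GRing.Theory Num.Theory.
Import numFieldNormedType.Exports.

Local Open Scope classical_set_scope.
Local Open Scope ring_scope.

(* Lebesgue measure on R^N: the Caratheodory measure of the outer measure given
   by countable covers by half-open boxes. [None] is the empty box, so that
   finite covers are allowed in every dimension, N = 0 included. *)
Section lebesgue_rV.
Context {R : realType} {N : nat}.
Local Open Scope ereal_scope.

Definition box (c : option ('rV[R]_N * 'rV[R]_N)) : set 'rV[R]_N :=
  if c is Some (a, b) then [set x | forall i, (a 0%R i < x 0%R i <= b 0%R i)%R]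
  else set0.

Definition box_volume (c : option ('rV[R]_N * 'rV[R]_N)) : \bar R :=
  if c is Some (a, b) then (\prod_(i < N) Num.max 0 (b 0 i - a 0 i))%:E else 0.

Definition box_cover (A : set 'rV[R]_N) :=
  [set c : nat -> option ('rV[R]_N * 'rV[R]_N) |
    A `<=` \bigcup_k box (c k)].

Definition lebesgue_outer (A : set 'rV[R]_N) : \bar R :=
  ereal_inf [set \sum_(k <oo) box_volume (c k) | c in box_cover A].

Lemma box_volume_ge0 c : 0 <= box_volume c.
Proof.
case: c => [[a b]|]//=; rewrite lee_fin; apply: prodr_ge0 => i _.
by rewrite le_max lexx.
Qed.

Lemma lebesgue_outer_ge0 A : 0 <= lebesgue_outer A.
Proof.
apply: le_ereal_inf_tmp => _ [c _ <-].
by apply: nneseries_ge0 => k _ _; exact: box_volume_ge0.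
Qed.

Lemma lebesgue_outer0 : lebesgue_outer set0 = 0.
Proof.
apply/eqP; rewrite eq_le lebesgue_outer_ge0 andbT.
apply: ereal_inf_lbound; exists (fun=> None) => //.
by rewrite eseries0.
Qed.

Lemma le_lebesgue_outer :
  {homo lebesgue_outer : A B / A `<=` B >-> A <= B}.
Proof.
move=> A B AB; apply: ereal_inf_le_tmp => _ [c Bc <-].
by exists c => //; exact: subset_trans Bc.
Qed.

Lemma lebesgue_outer_sigma_subadditive : sigma_subadditive lebesgue_outer.
Proof.
move=> A; have [[i ioo]|] := pselect (exists i, lebesgue_outer (A i) = +oo).
  rewrite (eseries_pinfty _ _ ioo) ?leey// => n _.
  by rewrite -ltNye (lt_le_trans _ (lebesgue_outer_ge0 _)).
rewrite -forallNE => Aoo.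
apply/lee_addgt0Pr => _/posnumP[e].
rewrite (le_trans _ (epsilon_trick _ _ _))//; last first.
  by move=> n; exact: lebesgue_outer_ge0.
pose P n (B : nat -> option ('rV[R]_N * 'rV[R]_N)) := box_cover (A n) B /\
  \sum_(k <oo) box_volume (B k) <=
    lebesgue_outer (A n) + (e%:num / (2 ^ n.+1)%:R)%:E.
have [G PG] : {G & forall n, P n (G n)}.
  apply: (@choice _ _ P) => n; rewrite /P /lebesgue_outer.
  set S := (X in ereal_inf X); move infS : (ereal_inf S) => iS.
  case: iS infS => [r Sr|Soo|Soo].
  - have en1 : (0 < e%:num / (2 ^ n.+1)%:R)%R by [].
    have /(lb_ereal_inf_adherent en1) : ereal_inf S \is a fin_num by rewrite Sr.
    move=> [x [B AnB muBx] xS].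
    by exists B; split => //; rewrite muBx -Sr; exact/ltW.
  - by have := Aoo n; rewrite /lebesgue_outer Soo.
  - by have := lebesgue_outer_ge0 (A n); rewrite /lebesgue_outer Soo.
have muG_ge0 x : 0 <= (box_volume \o uncurry G) x by exact: box_volume_ge0.
apply: (@le_trans _ _ (\esum_(i in setT) (box_volume \o uncurry G) i)).
  apply: ereal_inf_lbound => /=.
  have /card_esym/ppcard_eqP[f] := card_nat2.
  exists (uncurry G \o f).
    move=> t [i _ Ait]; have [j _ Gt] := (PG i).1 _ Ait.
    by exists (f^-1%FUN (i, j)) => //=; rewrite invK ?inE.
  rewrite -(esum_pred_image (box_volume \o uncurry G) _ xpredT) ?[fun=> _]set_true//.
  by rewrite image_eq.
rewrite (_ : esum _ _ = \sum_(i <oo) \sum_(j <oo ) box_volume (G i j)); last first.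
  pose J : nat -> set (nat * nat) := fun i => [set (i, j) | j in setT].
  rewrite (_ : setT = \bigcup_k J k); last first.
    by rewrite predeqE => -[a b]; split => // _; exists a => //; exists b.
  rewrite esum_bigcupT /=; last 2 first.
    - apply/trivIsetP => i j _ _ ij.
      rewrite predeqE => -[n m] /=; split => //= -[] [_] _ [<-{n} _].
      by move=> [m' _] [] /esym/eqP; rewrite (negbTE ij).
    - by move=> /= [n m]; exact: box_volume_ge0.
  rewrite -(image_id [set: nat]) -fun_true esum_pred_image//; last first.
    by move=> n _; apply: esum_ge0 => x _; exact: box_volume_ge0.
  apply: eq_eseriesr => /= j _.
  rewrite -(esum_pred_image (box_volume \o uncurry G) (pair j) predT)//=; last first.
    by move=> ? ? _ _; exact: (@can_inj _ _ _ snd).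
    by move=> *; exact: box_volume_ge0.
  by congr esum; rewrite predeqE => -[a b]; split; move=> [i _ <-]; exists i.
apply: lee_lim.
- apply: is_cvg_nneseries => n *.
  by apply: nneseries_ge0 => m *; exact: (muG_ge0 (n, m)).
- by apply: is_cvg_nneseries => n *; apply: adde_ge0 => //; exact: lebesgue_outer_ge0.
- by near=> n; apply: lee_sum => i _; exact: (PG i).2.
Unshelve. all: by end_near. Qed.

HB.instance Definition _ := isOuterMeasure.Build R 'rV[R]_N lebesgue_outer
  lebesgue_outer0 lebesgue_outer_ge0 le_lebesgue_outer
  lebesgue_outer_sigma_subadditive.

(* R^N with the sigma-algebra of Lebesgue measurable sets *)
Notation lebesgue_rV_type := (caratheodory_type lebesgue_outer).

Definition lebesgue_rV : set lebesgue_rV_type -> \bar R := lebesgue_outer.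

HB.instance Definition _ := isMeasure.Build _ lebesgue_rV_type R lebesgue_rV
  (@caratheodory_measure0 _ _ lebesgue_outer)
  (@caratheodory_measure_ge0 _ _ lebesgue_outer)
  (@caratheodory_measure_sigma_additive _ _ lebesgue_outer).

Let mulr_split (j : 'I_N) (a b : 'rV[R]_N) (a' b' : R) :
  (Num.max 0 (b' - a 0 j) + Num.max 0 (b 0 j - a') =
   Num.max 0 (b 0 j - a 0 j))%R ->
  (\prod_(i < N) Num.max 0
     ((\row_i if i == j then b' else b 0 i) 0 i - a 0 i) +
   \prod_(i < N) Num.max 0
     (b 0 i - (\row_i if i == j then a' else a 0 i) 0 i) =
   \prod_(i < N) Num.max 0 (b 0 i - a 0 i))%R.
Proof.
move=> h; rewrite [X in (X + _)%R](bigD1 j)//= [X in (_ + X)%R](bigD1 j)//=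
  [RHS](bigD1 j)//= !mxE eqxx -h mulrDl.
by congr (_ * _ + _ * _)%R; apply: eq_bigr => i /negbTE ij; rewrite mxE ij.
Qed.

Lemma measurable_halfspace (j : 'I_N) (t : R) :
  measurable ([set x | (x 0 j <= t)%R] : set lebesgue_rV_type).
Proof.
apply: le_caratheodory_measurable => X; apply: le_ereal_inf_tmp => _ [c Xc <-].
pose cl k := if c k is Some (a, b) then
  Some (a, (\row_i if i == j then Num.min (b 0 j) t else b 0 i)%R) else None.
pose cr k := if c k is Some (a, b) then
  Some ((\row_i if i == j then Num.max (a 0 j) t else a 0 i)%R, b) else None.
have -> : \sum_(k <oo) box_volume (c k) =
    \sum_(k <oo) box_volume (cl k) + \sum_(k <oo) box_volume (cr k).
  rewrite -nneseriesD//; [|by move=> *; exact: box_volume_ge0..].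
  apply: eq_eseriesr => k _; rewrite /cl /cr; case: (c k) => [[a b]|]/=; last first.
    by rewrite adde0.
  rewrite -EFinD mulr_split//.
  move: (a 0%R j) (b 0%R j) => x y; rewrite !maxEle !minEle.
  by do ![case: ifPn; rewrite -?ltNge] => *; lra.
apply: leeD; apply: ereal_inf_lbound.
  exists cl => // x [Xx /= xt]; have [k _ ckx] := Xc _ Xx; exists k => //.
  move: ckx; rewrite /cl; case: (c k) => [[a b]|]//= abx i; rewrite mxE.
  have := abx i; case: eqP => [->|//] /andP[-> ?]/=.
  by rewrite le_min xt andbT.
exists cr => // x [Xx /= /negP xt]; have [k _ ckx] := Xc _ Xx; exists k => //.
move: ckx; rewrite /cr; case: (c k) => [[a b]|]//= abx i; rewrite mxE.
have := abx i; case: eqP => [->|//] /andP[ax ->]/=.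
by move: xt; rewrite andbT gt_max ax -ltNge => ->.
Qed.

Lemma measurable_box c : measurable (box c : set lebesgue_rV_type).
Proof.
case: c => [[a b]|]; last exact: measurable0.
have -> : box (Some (a, b)) = \bigcap_(i in [set: 'I_N])
    ([set x | (x 0 i <= b 0 i)%R] `\` [set x | (x 0 i <= a 0 i)%R]).
  apply/seteqP; split=> [x abx i _|x abx i].
    by have /andP[/= ? ?] := abx i; split => //=; apply/negP; rewrite -ltNge.
  by have [/= -> /negP] := abx i I; rewrite -ltNge => ->.
apply: fin_bigcap_measurable; first exact: finite_finset.
by move=> i _; apply: measurableD; exact: measurable_halfspace.
Qed.

Lemma lebesgue_box_le c : lebesgue_rV (box c) <= box_volume c.
Proof.
apply: ereal_inf_lbound; exists (fun k => if k == 0%N then c else None).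
  by move=> x cx; exists 0%N.
rewrite (@nneseriesD1 _ _ 0%N)//; last by move=> k _; exact: box_volume_ge0.
by rewrite eqxx eseries0 ?adde0// => k _ /= /negbTE->.
Qed.

Lemma lebesgue_rV_sigma_finite : sigma_finite [set: lebesgue_rV_type] lebesgue_rV.
Proof.
exists (fun n : nat => box (Some (const_mx (- n%:R)%R, const_mx n%:R%R))).
  apply/esym/seteqP; split => // x _.
  have [M xM] : exists M : nat, forall i, (`|x 0%R i| < M%:R)%R.
    exists (\max_(i < N) Num.bound `|x 0%R i|)%N => i.
    apply: (lt_le_trans (archi_boundP (normr_ge0 _))).
    by rewrite ler_nat; exact: (@leq_bigmax _ (fun i => Num.bound `|x 0%R i|)).
  exists M => // i; rewrite !mxE.
  by have := xM i; rewrite ltr_norml => /andP[-> /ltW].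
move=> n; split; first exact: measurable_box.
by rewrite (le_lt_trans (lebesgue_box_le _))//= ltry.
Qed.

HB.instance Definition _ := Measure_isSigmaFinite.Build _ lebesgue_rV_type R
  lebesgue_rV lebesgue_rV_sigma_finite.

End lebesgue_rV.
Arguments lebesgue_rV R N : clear implicits.

Notation lebesgue_rV_type R N := (caratheodory_type (@lebesgue_outer R N)).

Section domains.
Context {R : realType} {N : nat}.

(* Euclidean norm; the library norm of 'rV[R]_N is the sup norm *)
Definition enorm (x : 'rV[R]_N) : R := Num.sqrt (\sum_(i < N) x 0 i ^+ 2).

Definition boundary (A : set 'rV[R]_N) := closure A `\` interior A.

(* Near each boundary point, in suitable orthonormal coordinates (the columns
   of Q), the set is the part of a ball above the graph of a Lipschitz function
   of all the coordinates but the k-th one. *)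
Definition lipschitz_boundary (A : set 'rV[R]_N) :=
  forall x0, boundary A x0 ->
  exists (Q : 'M[R]_N) (k : 'I_N) (gamma : 'rV[R]_N.-1 -> R) (r : R),
    [/\ Q *m Q^T = 1%:M, lipschitz gamma, 0 < r &
        forall x, enorm (x - x0) < r ->
          (A x <-> gamma (col' k (x *m Q)) < (x *m Q) 0 k)].

Definition bounded_lipschitz_domain (A : set 'rV[R]_N) :=
  [/\ open A, connected A, A !=set0, bounded_set A & lipschitz_boundary A].

End domains.

Section musielak_sobolev.
Context {R : realType} {N : nat}.
Local Notation vec := 'rV[R]_N.
Local Notation X := (lebesgue_rV_type R N).
Local Notation leb := (lebesgue_rV R N).
Local Notation leb2 := (leb \x leb)%E.

(* G_{x,y}(t), the integral of g(x,y,tau) = a_{x,y}(tau) tau over [0,|t|];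
   the factor tau makes g(x,y,0) = 0 whatever the value of a at tau = 0. *)
Definition primitiveG (a : vec -> vec -> R -> R) (x y : vec) (t : R) : R :=
  \int[@lebesgue_measure R]_(tau in `[0, `|t|]) (a x y tau * tau).

Definition caratheodory_function (D : set (X * X)) (F : vec -> vec -> R -> R) :=
  (forall t, measurable_fun D (fun z : X * X => F z.1 z.2 t)) /\
  {ae leb2, forall z, D z -> continuous (F z.1 z.2)}.

(* D_{s(.,.)} u (x, y); it is 0 on the diagonal, which is negligible *)
Definition frac_quot (s : vec * vec -> R) (u : vec -> R) (x y : vec) : R :=
  (u x - u y) / enorm (x - y) `^ s (x, y).

(* density of mu = dx dy / |x - y|^N *)
Definition mu_density (x y : vec) : R := (enorm (x - y) ^+ N)^-1.

Variables (Omega : set vec) (s : vec * vec -> R).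

Section spaces.
Variable G : vec -> vec -> R -> R.

Definition modular_hat (u : vec -> R) : \bar R :=
  \int[leb]_(x in (Omega : set X)) (G x x `|u x|)%:E.

(* Functions on Omega are represented by total functions; only their values on
   Omega matter. *)
Definition musielak_orlicz : set (vec -> R) :=
  [set u : vec -> R | measurable_fun (Omega : set X) (u : X -> R) /\
    exists2 lambda : R, 0 < lambda &
      (modular_hat (fun x => lambda * u x)%R < +oo)%E].

Definition modular_frac (u : vec -> R) : \bar R :=
  \int[leb2]_(z in (Omega : set X) `*` (Omega : set X))
    (G z.1 z.2 (frac_quot s u z.1 z.2) * mu_density z.1 z.2)%:E.

Definition musielak_sobolev : set (vec -> R) :=
  [set u : vec -> R | musielak_orlicz u /\
    exists2 lambda : R, 0 < lambda &
      (modular_frac (fun x => lambda * u x)%R < +oo)%E].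

End spaces.

Definition lebesgue_var (q : vec -> R) : set (vec -> R) :=
  [set u : vec -> R | measurable_fun (Omega : set X) (u : X -> R) /\
    (\int[leb]_(x in (Omega : set X)) (`|u x| `^ q x)%:E < +oo)%E].

(* The three integrals are required to converge absolutely, so that the real
   integrals in the identity are meaningful. *)
Definition weak_solution (a : vec -> vec -> R -> R) (h m : vec -> R)
    (u : vec -> R) :=
  let W := musielak_sobolev (primitiveG a) in
  let Du := frac_quot s u in
  [/\ W u,
      forall x, Omega x -> 0 < u x &
      forall v, W v ->
        let Dv := frac_quot s v in
        let f1 (z : X * X) := a z.1 z.2 `|Du z.1 z.2| * Du z.1 z.2
                              * Dv z.1 z.2 * mu_density z.1 z.2 in
        let f2 (x : X) := a x x `|u x| * u x * v x in
        let f3 (x : X) := h x / u x `^ m x * v x in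
        let O : set X := Omega in
        [/\ leb2.-integrable (O `*` O) (EFin \o f1),
            leb.-integrable O (EFin \o f2),
            leb.-integrable O (EFin \o f3) &
            \int[leb2]_(z in O `*` O) f1 z + \int[leb]_(x in O) f2 x
              = \int[leb]_(x in O) f3 x]].

End musielak_sobolev.

(* Main.v *)
(* The energy J(u) = int int G(D u) dmu + int (G(u) - h u^(1-m) / (1-m)) dx is
   convex on nonnegative functions, since u^(1-m) is concave in u, and on a bounded
   domain the singular term is dominated by half of the Musielak-Orlicz term. So
   no embedding or weak compactness is needed: the strict concavity of t^b,
   quantified by
     2 ((s+t)/2)^b - s^b - t^b >= b(1-b)/2 (sqrt s - sqrt t)^2 / (1 + (s+t)/2),
   makes the square roots of a fast minimizing sequence converge almost everywhere,
   and Fatou's lemma yields a minimizer u over all nonnegative measurable functions.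
   Constants are admissible directions with D 1 = 0, and comparing u with u + 1/n
   forces u > 0 almost everywhere, because the singular term gains n^m on {u = 0}.
   Comparing u with (u + v/n)^+ gives int h u^(-m) v <= <J0'(u), v> for every v of
   finite energy, J0 being the convex part of J; replacing v by -v turns this into
   the weak equation. *)

Require Import Defs.
From mathcomp Require Import all_boot all_order all_algebra.
From mathcomp Require Import all_classical all_reals all_analysis.
From mathcomp Require Import measurable_realfun ring lra.
Import Order.TTheory GRing.Theory Num.Theory.
Import numFieldNormedType.Exports.
Local Open Scope classical_set_scope.
Local Open Scope ring_scope.

Set Implicit Arguments.
Unset Strict Implicit.

(** * Powers with exponent in (0, 1) *)

(** For compactness, [G] supplies only convexity, continuity and at least linear growth; strictness
    has to come from the singular term. On the compact closure of [Omega], [h] lies between two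
    positive constants and [m] between two constants in (0, 1), so the concavity gap is bounded
    below uniformly in [x]. The energy bounds the weight [1 + (s + t) / 2] in L^1, and the
    Cauchy-Schwarz inequality turns a gap of order 4^-n into L^1 increments of the square roots of
    order 2^-n. The growth bound [gp] yields a doubling constant; hence finiteness of a modular
    survives scaling and addition, and every member of the space is a direction of finite energy.
    The obstacle in the variation is that nothing is known beforehand about the integrability of
    [h u^(-m) v]: for [v >= 0] it follows from Fatou's lemma, since minimality bounds the difference
    quotients of the singular term by those of the convex part, and this supplies the majorant for
    signed [v]. *)

Lemma powRB1 {R : realType} (x b : R) : 0 < x -> x `^ (b - 1) = x `^ b / x.
Proof.
move=> x0; rewrite powRB ?powRr1//; first exact: ltW.
by rewrite (gt_eqF x0) implybT.
Qed.

(** Young's inequality for the product of [x^b] and 1 with the conjugate exponents [1/b] and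
    [1/(1-b)]. *)
Lemma powR_le_tangent {R : realType} (x b : R) :
  0 <= x -> 0 < b < 1 -> x `^ b <= 1 + b * (x - 1).
Proof.
move=> x0 /andP[b0 b1].
have q0 : 0 < (1 - b)^-1 by rewrite invr_gt0 subr_gt0.
have p0 : 0 < b^-1 by rewrite invr_gt0.
have := @conjugate_powR _ (x `^ b) 1 _ _ (powR_ge0 _ _) ler01 p0 q0.
rewrite !invrK -powRrM mulfV ?gt_eqF// powRr1// powR1 mulr1 => /(_ _).
by have -> : b + (1 - b) = 1 by [ring]; move=> /(_ erefl) h; apply: (le_trans h); lra.
Qed.

(* Squaring the tangent-line bound taken at [Num.sqrt x] gains the quadratic term. *)
Lemma powR_le_strong_tangent {R : realType} (x b : R) : 0 <= x -> 0 < b < 1 ->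
  x `^ b <= 1 + b * (x - 1) - b * (1 - b) * (Num.sqrt x - 1) ^+ 2.
Proof.
move=> x0 b01; have s0 := sqrtr_ge0 x.
have h := powR_le_tangent s0 b01.
have -> : x `^ b = (Num.sqrt x `^ b) ^+ 2.
  by rewrite -[in LHS](sqr_sqrtr x0) -powR_mulrn// powRAC powR_mulrn// powR_ge0.
have xE : x = Num.sqrt x ^+ 2 by rewrite sqr_sqrtr.
rewrite [in leRHS]xE sqrtr_sqr ger0_norm//.
have p0 := powR_ge0 (Num.sqrt x) b.
have : (Num.sqrt x `^ b) ^+ 2 <= (1 + b * (Num.sqrt x - 1)) ^+ 2.
  by rewrite ler_sqr ?nnegrE// (le_trans p0 h).
move/le_trans; apply; rewrite le_eqVlt; apply/orP; left; apply/eqP; ring.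
Qed.

(** Both sides are compared with [min(w, 1)]. The lower bound is free of [b], so the weight in the
    midpoint gap is the same for all exponents. *)
Lemma powR_ge_ratio {R : realType} (w b : R) :
  0 <= w -> 0 < b < 1 -> w / (1 + w) <= w `^ b.
Proof.
move=> w0 /andP[b0 b1].
have w10 : 0 < 1 + w by lra.
have [w1|w1] := leP w 1.
  have [->|wn0] := eqVneq w 0; first by rewrite mul0r powR_ge0.
  have wp : 0 < w by rewrite lt0r wn0.
  apply: (@le_trans _ _ w).
    by rewrite ler_pdivrMr// mulrDr mulr1 lerDl mulr_ge0.
  by apply: ger1_powR; [rewrite wp w1 | exact: ltW].
apply: (@le_trans _ _ 1).
  by rewrite ler_pdivrMr// mul1r lerDr.
have := @ler_powR _ w (ltW w1) 0 b (ltW b0).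
by rewrite powRr0.
Qed.

(** The strong tangent bound is rescaled to the midpoint [w] and applied to [u] and to [v]; the
    linear terms cancel because [u + v = 2 w]. The remaining factor [w^b / w] is at least
    [1 / (1 + w)]. *)
Lemma powR_midpoint_gap {R : realType} (u v b : R) :
  0 <= u -> 0 <= v -> 0 < b < 1 ->
  b * (1 - b) / 2 * ((Num.sqrt u - Num.sqrt v) ^+ 2 / (1 + (u + v) / 2)) <=
  2 * ((u + v) / 2) `^ b - u `^ b - v `^ b.
Proof.
move=> u0 v0 b01; set w := (u + v) / 2.
have b0 : 0 < b by case/andP: b01.
have b1 : b < 1 by case/andP: b01.
have w0 : 0 <= w by rewrite /w; lra.
have [wz|wn0] := eqVneq w 0.
  have uz : u = 0 by move: wz; rewrite /w; lra.
  have vz : v = 0 by move: wz; rewrite /w; lra.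
  by rewrite wz uz vz !powR0 ?gt_eqF// subrr expr0n/= mul0r !mulr0 !subr0.
have wp : 0 < w by rewrite lt0r wn0.
have key z : 0 <= z -> z `^ b <=
    w `^ b * (1 + b * (z / w - 1)
    - b * (1 - b) * (Num.sqrt z - Num.sqrt w) ^+ 2 / w).
  move=> z0; have zw0 : 0 <= z / w by rewrite divr_ge0.
  have := powR_le_strong_tangent zw0 b01.
  have -> : z `^ b = w `^ b * (z / w) `^ b.
    by rewrite -powRM// mulrC divfK.
  rewrite ler_pM2l ?powR_gt0// => /le_trans; apply.
  rewrite sqrtrM// sqrtrV//.
  have sw : Num.sqrt w != 0 by rewrite gt_eqF// sqrtr_gt0.
  have wE : w = Num.sqrt w ^+ 2 by rewrite sqr_sqrtr.
  have -> : (Num.sqrt z / Num.sqrt w - 1) ^+ 2 = (Num.sqrt z - Num.sqrt w) ^+ 2 / w.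
    by rewrite [in RHS]wE sqrtr_sqr ger0_norm ?sqrtr_ge0//; field.
  by rewrite le_eqVlt; apply/orP; left; apply/eqP; ring.
have ku := key _ u0; have kv := key _ v0.
have := lerD ku kv.
set P := w `^ b in ku kv *.
have hP : w / (1 + w) <= P by exact: powR_ge_ratio.
set su := Num.sqrt u; set sv := Num.sqrt v; set sw := Num.sqrt w.
have uvw : u / w + v / w = 2.
  by apply: (mulIf wn0); rewrite -mulrDl divfK// /w; field.
move=> h.
have {h} : u `^ b + v `^ b <= 2 * P -
   b * (1 - b) * (P / w) * ((su - sw) ^+ 2 + (sv - sw) ^+ 2).
  apply: (le_trans h); rewrite le_eqVlt; apply/orP; left; apply/eqP.
  have -> : v / w = 2 - u / w by rewrite -uvw; ring.
  by field; rewrite gt_eqF.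
move=> h.
have c0 : 0 < b * (1 - b) by rewrite mulr_gt0// subr_gt0.
have Pw : (1 + w)^-1 <= P / w.
  by rewrite ler_pdivlMr// mulrC.
have d : (su - sv) ^+ 2 / 2 <= (su - sw) ^+ 2 + (sv - sw) ^+ 2.
  have := sqr_ge0 (su + sv - 2 * sw); rewrite !expr2; lra.
have iw0 : 0 <= (1 + w)^-1 by rewrite invr_ge0; lra.
have : b * (1 - b) * ((1 + w)^-1 * ((su - sv) ^+ 2 / 2)) <=
  b * (1 - b) * ((P / w) * ((su - sw) ^+ 2 + (sv - sw) ^+ 2)).
  rewrite ler_pM2l//; apply: ler_pM => //.
  by rewrite divr_ge0// sqr_ge0.
have -> : b * (1 - b) / 2 * ((su - sv) ^+ 2 / (1 + w)) =
  b * (1 - b) * ((1 + w)^-1 * ((su - sv) ^+ 2 / 2)) by ring.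
lra.
Qed.

(** The tangent of [t^b] at [K] lies above the graph and has slope at most [K^(b-1)]. Since
    [K >= 1], this is at most [K^(bp-1)], which the choice of [K] makes at most [e]; one constant
    thus serves all exponents up to [bp]. *)
Lemma powR_le_lin {R : realType} (bp e : R) : 0 < bp < 1 -> 0 < e ->
  exists C : R, 0 <= C /\
    forall b t, 0 < b <= bp -> 0 <= t -> t `^ b <= e * t + C.
Proof.
move=> /andP[bp0 bp1] e0.
pose K := Num.max 1 (e `^ (bp - 1)^-1).
have K1 : 1 <= K by rewrite le_max lexx.
have K0 : 0 < K by apply: lt_le_trans K1.
exists K; split; first exact: ltW.
move=> b t /andP[b0 bbp] t0.
have b1 : b < 1 by apply: le_lt_trans bp1.
have b01 : 0 < b < 1 by rewrite b0.
have tK0 : 0 <= t / K by rewrite divr_ge0// ltW.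
have -> : t `^ b = K `^ b * (t / K) `^ b.
  by rewrite -powRM// ?(ltW K0)// mulrC divfK// gt_eqF.
have h := powR_le_tangent tK0 b01.
have KbK : K `^ b <= K by rewrite ler1_powR// ltW.
have Kb : K `^ b / K <= e.
  have -> : K `^ b / K = K `^ (b - 1).
    by rewrite powRB1.
  apply: (@le_trans _ _ (K `^ (bp - 1))).
    by apply: ler_powR => //; lra.
  have nz : (bp - 1) != 0 by rewrite lt_eqF// subr_lt0.
  have -> : e = (e `^ (bp - 1)^-1) `^ (bp - 1).
    by rewrite -powRrM mulVf// powRr1// ltW.
  have -> : bp - 1 = - (1 - bp) by ring.
  rewrite !(powRN _ (1 - bp)) lef_pV2 ?posrE ?powR_gt0//.
  have -> : - (1 - bp) = bp - 1 by ring.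
  apply: ge0_ler_powR; rewrite ?nnegrE ?powR_ge0 ?(ltW K0)//; first by lra.
  by rewrite /K le_max lexx orbT.
have Kbp := powR_gt0 b K0.
apply: (@le_trans _ _ (K `^ b * (1 + t / K))).
  rewrite ler_pM2l//; apply: (le_trans h).
  have : b * (t / K) <= t / K by rewrite ler_piMl// ltW.
  lra.
have -> : K `^ b * (1 + t / K) = K `^ b / K * t + K `^ b by field; rewrite gt_eqF.
by apply: lerD => //; exact: ler_wpM2r.
Qed.

Lemma powR_supergradient {R : realType} (u e b : R) :
  0 < u -> 0 <= u + e -> 0 < b < 1 ->
  (u + e) `^ b <= u `^ b + b * u `^ (b - 1) * e.
Proof.
move=> u0 ue b01.
have h : 0 <= (u + e) / u by rewrite divr_ge0// ltW.
have := powR_le_tangent h b01.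
have -> : (u + e) `^ b = u `^ b * ((u + e) / u) `^ b.
  by rewrite -powRM// ?(ltW u0)// mulrC divfK// gt_eqF.
rewrite -(ler_pM2l (powR_gt0 b u0)) => /le_trans; apply.
rewrite powRB1//.
by rewrite le_eqVlt; apply/orP; left; apply/eqP; field; rewrite gt_eqF.
Qed.

(** After division by [u] this is [l <= l^b] on (0, 1]. The factor [b] of the tangent slope is lost
    on this side: at [e = - u] the two sides agree. *)
Lemma powR_trunc_decrement {R : realType} (u e b : R) : 0 < u -> e <= 0 -> 0 < b < 1 ->
  u `^ b - Num.max 0 (u + e) `^ b <= u `^ (b - 1) * - e.
Proof.
move=> u0 e0 /andP[b0 b1].
have ub := powR_gt0 b u0.
have uE : u `^ (b - 1) = u `^ b / u.
  by rewrite powRB1.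
have [ue|ue] := leP (u + e) 0.
  rewrite powR0 ?gt_eqF// subr0 uE.
  by rewrite -mulrA ler_peMr ?(ltW ub)// ler_pdivlMl// mulr1; lra.
have l0 : 0 < (u + e) / u <= 1.
  by rewrite divr_gt0//= ler_pdivrMr// mul1r; lra.
have := ger1_powR l0 (ltW b1).
have -> : (u + e) `^ b = u `^ b * ((u + e) / u) `^ b.
  by rewrite -powRM// ?(ltW u0)// ?ltW ?divr_gt0// mulrC divfK// gt_eqF.
rewrite -(ler_pM2l ub) uE => h.
have -> : u `^ b / u * - e = u `^ b - u `^ b * ((u + e) / u).
  by field; rewrite gt_eqF.
lra.
Qed.

(** Provides the majorant for the difference quotients of the singular term, uniform in the step and
    unaffected by the truncation. *)
Lemma powR_trunc_lip {R : realType} (u e b : R) : 0 < u -> 0 < b < 1 ->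
  `|Num.max 0 (u + e) `^ b - u `^ b| <= u `^ (b - 1) * `|e|.
Proof.
move=> u0 b01; have /andP[b0 b1] := b01.
have c0 := powR_ge0 u (b - 1).
have [e0|/ltW e0] := leP 0 e.
  have s0 : 0 <= u + e by rewrite addr_ge0// ltW.
  have us : u `^ b <= (u + e) `^ b.
    by apply: ge0_ler_powR; rewrite ?nnegrE ?(ltW b0) ?(ltW u0)// lerDl.
  rewrite (max_idPr s0) !ger0_norm ?subr_ge0// lerBlDl.
  apply: (le_trans (powR_supergradient u0 s0 b01)); rewrite lerD2l -mulrA.
  by rewrite ler_piMl ?(ltW b1)// mulr_ge0.
have h1 := powR_trunc_decrement u0 e0 b01.
have h2 : Num.max 0 (u + e) `^ b <= u `^ b.
  apply: ge0_ler_powR; rewrite ?nnegrE ?(ltW b0) ?(ltW u0)//.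
    by rewrite le_max lexx.
  by rewrite ge_max (ltW u0)/= gerDl.
by rewrite distrC ger0_norm ?subr_ge0// (ler0_norm e0).
Qed.

(** * Young functions *)

Lemma diff_quotient_powR_cvg {R : realType} (u e b : R) : 0 < u ->
  n.+1%:R * ((u + e / n.+1%:R) `^ b - u `^ b) @[n --> \oo]
  --> b * u `^ (b - 1) * e.
Proof.
move=> u0; have [->|e0] := eqVneq e 0.
  rewrite mulr0; under eq_fun do rewrite mul0r addr0 subrr mulr0.
  exact: cvg_cst.
have [/cvg_ex[/= l hl] dE] := @is_derive1_powR _ b u u0.
have {}hl : h^-1 *: (((h%:A + u) `^ b) - u `^ b) @[h --> 0^'] --> b * u `^ (b - 1).
  by rewrite -dE /derive (cvg_lim _ hl).
pose hn (n : nat) := e / n.+1%:R.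
have hn0 : hn n @[n --> \oo] --> 0^'.
  move=> A [r/= r0 rA].
  have : hn n @[n --> \oo] --> 0.
    rewrite -(mulr0 e); apply: cvgMl_tmp; exact: (@cvg_harmonic R).
  move/cvgrPdist_lt => /(_ _ r0) [k _ kP]; exists k => // n /= kn.
  apply: rA; first by have := kP _ kn.
  by rewrite mulf_neq0// invr_eq0 pnatr_eq0.
have hc := cvg_comp _ _ hn0 hl.
have hM := cvgM hc (cvg_cst e).
rewrite [X in X @ _ --> _](_ : _ = (((fun h : R =>
    h^-1 *: ((h%:A + u) `^ b - u `^ b)) \o hn) \* cst e)); first exact: hM.
apply/funext => n; rewrite /= /hn.
rewrite /GRing.scale/= mulr1 invf_div [u + _]addrC.
by rewrite [in RHS]mulrAC mulrC divfK// mulrC.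
Qed.

(* [gam] is the derivative of the even convex function [G], which doubles at cost [K]. *)
Record young_pair {R : realType} (K : R) (G gam : R -> R) : Prop := YoungPair {
  young0 : G 0 = 0 ;
  youngN : forall t, G (- t) = G t ;
  young_homo : forall s t, 0 <= s -> s <= t -> G s <= G t ;
  young_subgrad : forall d d', G d + gam d * (d' - d) <= G d' ;
  young_cont : continuous gam ;
  young_double : forall t, G (2 * t) <= K * G t }.

Section young_pair_theory.
Context {R : realType} (K : R) (G gam : R -> R) (Y : young_pair K G gam).

Lemma young_norm t : G `|t| = G t.
Proof. by case: (ger0P t) => // _; rewrite (youngN Y). Qed.

Lemma young_le s t : `|s| <= `|t| -> G s <= G t.
Proof. by rewrite -(young_norm s) -(young_norm t); exact: (young_homo Y). Qed.

Lemma young_ge0 t : 0 <= G t.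
Proof. by rewrite -(young0 Y); apply: young_le; rewrite normr0. Qed.

Lemma young_mid s t : G ((s + t) / 2) <= (G s + G t) / 2.
Proof.
have h1 := young_subgrad Y ((s + t) / 2) s.
have h2 := young_subgrad Y ((s + t) / 2) t.
move: (gam _) h1 h2 => c h1 h2.
have e1 : c * (s - (s + t) / 2) = - (c * (t - (s + t) / 2)) by field.
lra.
Qed.

Lemma young_mid_le s t : G ((s + t) / 2) <= G s + G t.
Proof.
apply: (le_trans (young_mid s t)).
have := young_ge0 s; have := young_ge0 t; lra.
Qed.

Lemma young_diff_ge d e : gam d * e <= G (d + e) - G d.
Proof.
have := young_subgrad Y d (d + e); have -> : d + e - d = e by ring.
lra.
Qed.

Lemma young_diff_le d e : G (d + e) - G d <= gam (d + e) * e.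
Proof.
have := young_subgrad Y (d + e) d; have -> : d - (d + e) = - e by ring.
rewrite mulrN; lra.
Qed.

(** Subgradients at [d] and at a nearby [x] trap [G x - G d] between two multiples of [x - d];
    continuity of [gam] bounds both slopes. *)
Lemma young_continuous : continuous G.
Proof.
move=> d; apply/cvgrPdist_le => _/posnumP[e].
have /cvgrPdist_le/(_ 1 ltr01) := @young_cont _ _ _ _ Y d.
set c := 1 + `|gam d|; have c0 : 0 < c by rewrite ltr_pwDl.
have ec : 0 < e%:num / c by rewrite divr_gt0.
move=> h; near=> x.
have hx : `|gam x| <= c.
  have : `|gam d - gam x| <= 1 by near: x.
  by have := lerB_dist (gam x) (gam d); rewrite distrC /c; lra.
have hd : `|gam d| <= c by rewrite lerDr.
have dx : `|d - x| <= e%:num / c.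
  by near: x; exact: cvgr_dist_le.
have k1 := young_subgrad Y d x; have k2 := young_subgrad Y x d.
have b1 : `|gam d * (x - d)| <= e%:num.
  rewrite normrM distrC -(divfK (lt0r_neq0 c0) e%:num) mulrC.
  by apply: ler_pM.
have b2 : `|gam x * (d - x)| <= e%:num.
  rewrite normrM -(divfK (lt0r_neq0 c0) e%:num) mulrC.
  by apply: ler_pM.
move: b1 b2; rewrite !ler_norml => /andP[? ?] /andP[? ?]; lra.
Unshelve. all: by end_near. Qed.

Lemma young_scale_pow n t : 0 <= K -> G (2 ^+ n * t) <= K ^+ n * G t.
Proof.
move=> K0; elim: n => [|n ih]; first by rewrite !expr0 !mul1r.
rewrite !exprS -!mulrA; apply: (le_trans (young_double Y _)).
by rewrite ler_wpM2l.
Qed.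

Lemma young_add s t : 0 <= K -> G (s + t) <= K * (G s + G t).
Proof.
move=> K0; have -> : s + t = 2 * ((s + t) / 2) by rewrite mulrC divfK.
by apply: (le_trans (young_double Y _)); rewrite ler_wpM2l// young_mid_le.
Qed.

Lemma young_diff_quotient_cvg d e :
  n.+1%:R * (G (d + e / n.+1%:R) - G d) @[n --> \oo] --> gam d * e.
Proof.
have hn : d + e / n.+1%:R @[n --> \oo] --> d.
  rewrite -[X in _ --> X]addr0; apply: cvgD; first exact: cvg_cst.
  by rewrite -(mulr0 e); apply: cvgMl_tmp; exact: (@cvg_harmonic R).
have hg : gam (d + e / n.+1%:R) * e @[n --> \oo] --> gam d * e.
  apply: cvgMr_tmp; apply: (cvg_comp _ _ hn); exact: (@young_cont _ _ _ _ Y).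
apply: (@squeeze_cvgr _ _ _ _ (fun=> gam d * e) (fun n => gam (d + e / n.+1%:R) * e)).
- near=> n; have n0 : (0 < n.+1%:R :> R) by rewrite ltr0n.
  have := young_diff_ge d (e / n.+1%:R); have := young_diff_le d (e / n.+1%:R).
  rewrite -(ler_pM2l n0) => h1; rewrite -(ler_pM2l n0) => h2.
  apply/andP; split; [apply: le_trans h2|apply: (le_trans h1)];
    by rewrite le_eqVlt; apply/orP; left; apply/eqP; field.
- exact: cvg_cst.
- exact: hg.
Unshelve. all: by end_near. Qed.

Lemma young_grad_bound d e : `|gam d * e| <= G (d + e) + G (d - e).
Proof.
have h1 := young_diff_ge d e; have := young_diff_ge d (- e).
have g0 := young_ge0 d; have := young_ge0 (d + e); have := young_ge0 (d - e).
by rewrite ler_norml mulrN => ? ? ?; apply/andP; split; lra.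
Qed.

(** By convexity the quotient with step [1/k] is at most the one with step 1, and it is at least
    [gam d * e]. The resulting majorant does not depend on [n] and involves values of [G] only, so
    finite modulars make it integrable. *)
Lemma young_diff_quotient_bound d e (n : nat) :
  `|n.+1%:R * (G (d + e / n.+1%:R) - G d)| <= G (d + e) + G (d - e).
Proof.
set k : R := n.+1%:R; have k1 : 1 <= k by rewrite ler1n.
have k0 : 0 < k by apply: lt_le_trans k1.
have lb := young_diff_ge d (e / k).
have gb := young_grad_bound d e.
have e1 : k * (gam d * (e / k)) = gam d * e by field; rewrite gt_eqF.
have lb' : gam d * e <= k * (G (d + e / k) - G d) by rewrite -e1 ler_pM2l.
have h1 := young_subgrad Y (d + e / k) (d + e).
have h2 := young_subgrad Y (d + e / k) d.
move: (gam (d + _)) h1 h2 => c h1 h2.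
have e2 : c * (d + e - (d + e / k)) = (k - 1) * (c * (e / k)) by field; rewrite gt_eqF.
have e3 : c * (d - (d + e / k)) = - (c * (e / k)) by ring.
have ub : k * (G (d + e / k) - G d) <= G (d + e) - G d.
  move: h1 h2; rewrite e2 e3; move: (c * _) => q h1 h2.
  have : (k - 1) * G (d + e / k) - (k - 1) * q <= (k - 1) * G d.
    rewrite -mulrBr ler_wpM2l//; lra.
  lra.
have g0 := young_ge0 d; have := young_ge0 (d + e); have := young_ge0 (d - e).
move: gb; rewrite !ler_norml => /andP[? ?] ? ?; apply/andP; split; lra.
Qed.

End young_pair_theory.

(** * Young functions built from the density [a] *)

Section young_of_density.
Context {R : realType} (a : R -> R) (gm gp : R).
Local Notation leb1 := (@lebesgue_measure R).
Let G (t : R) := \int[leb1]_(tau in `[0, `|t|]) (a tau * tau).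
Let gam (t : R) := a `|t| * t.
Context (a_ge0 : forall t, 0 < t -> 0 <= a t).
Context (a_lim0 : a t * t @[t --> 0^'+] --> 0).
Context (a_cont : {in `]0, +oo[, continuous a}).
Context (a_incr :
  {in `]0, +oo[ &, {homo (fun t => a t * t) : t t' / t < t'}}).
Context (gm_gt1 : 1 < gm).
Context (G_growth : forall t, 0 < t -> gm <= a t * t ^+ 2 / G t <= gp).

Let gam_odd t : gam (- t) = - gam t.
Proof. by rewrite /gam normrN mulrN. Qed.

Let gam0 : gam 0 = 0.
Proof. by rewrite /gam mulr0. Qed.

Let gam_pos t : 0 <= t -> gam t = a t * t.
Proof. by move=> t0; rewrite /gam ger0_norm. Qed.

Let gam_ge0 t : 0 <= t -> 0 <= gam t.
Proof.
rewrite le_eqVlt => /predU1P[<-|t0]; first by rewrite gam0.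
by rewrite gam_pos ?mulr_ge0 ?(ltW t0) ?a_ge0.
Qed.

Let gam_homo s t : 0 <= s -> s <= t -> gam s <= gam t.
Proof.
rewrite le_eqVlt => /predU1P[<- t0|s0]; first by rewrite gam0 gam_ge0.
rewrite le_eqVlt => /predU1P[->//|st].
have t0 := lt_trans s0 st.
rewrite !gam_pos ?ltW//; apply: a_incr => //; by rewrite in_itv/= ?s0 ?t0.
Qed.

Let gam_cont_pos t : 0 < t -> {for t, continuous gam}.
Proof.
move=> t0; rewrite /prop_for /continuous_at (gam_pos (ltW t0)).
have h : a s * s @[s --> t] --> a t * t.
  by apply: cvgM; [apply: a_cont; rewrite in_itv/= t0|exact: cvg_id].
apply: cvg_trans h; apply: near_eq_cvg; near=> s.
by rewrite gam_pos// ltW//; near: s; exact: lt_nbhsr.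
Unshelve. all: by end_near. Qed.

Let gam_cont : continuous gam.
Proof.
move=> t; have [t0|t0|->] := ltgtP t 0.
- have -> : gam = (fun s => - gam (- s)) by apply/funext => s; rewrite gam_odd opprK.
  apply: cvgN; apply: (@continuous_comp _ _ _ -%R gam t); first exact: opp_continuous.
  by apply: gam_cont_pos; rewrite oppr_gt0.
- exact: gam_cont_pos.
- apply/cvgrPdist_le => e e0; rewrite gam0.
  have /cvgrPdist_le/(_ e e0) [d /= d0 dP] := a_lim0.
  near=> s.
  rewrite sub0r normrN.
  have -> : `|gam s| = gam `|s|.
    by rewrite /gam normrM normr_id; have [->|s0] := eqVneq s 0;
      rewrite ?normr0 ?mulr0// [in LHS]ger0_norm// a_ge0// normr_gt0.
  have [->|s0] := eqVneq s 0; first by rewrite normr0 gam0 ltW.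
  have : `|0 - a `|s| * `|s| | <= e.
    apply: dP; last by rewrite normr_gt0.
    rewrite /ball_/= sub0r normrN normr_id.
    near: s; apply/nbhs_ballP; exists d => //= z.
    by rewrite /ball/= sub0r normrN.
  rewrite sub0r normrN ger0_norm ?gam_pos//.
  by rewrite mulr_ge0// a_ge0// normr_gt0.
Unshelve. all: by end_near. Qed.

Let GE t : G t = \int[leb1]_(tau in `[0, `|t|]) gam tau.
Proof.
apply: eq_Rintegral => x; rewrite inE/= in_itv/= => /andP[x0 _].
by rewrite gam_pos.
Qed.

Let int_gam s t : leb1.-integrable `[s, t] (EFin \o gam).
Proof.
apply: continuous_compact_integrable; first exact: segment_compact.
by apply: continuous_subspaceT => x; exact: gam_cont.
Qed.

(** The integral of the monotone [gam] lies between the length of the interval times its end values;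
    monotonicity, convexity and doubling of [G] all rest on this. *)
Let G_diff s t : 0 <= s -> s <= t ->
  (t - s) * gam s <= G t - G s <= (t - s) * gam t.
Proof.
move=> s0 st; have t0 := le_trans s0 st.
rewrite !GE !ger0_norm// Rintegral_itvB; [|exact: int_gam|by rewrite bnd_simp..].
have i1 : leb1.-integrable `]s, t] (EFin \o gam).
  apply: integrableS (int_gam s t) => //.
  by apply: subset_itvr; rewrite bnd_simp.
have ic c : leb1.-integrable `]s, t] (EFin \o cst c).
  apply: (@integrableS _ _ _ leb1 `[s, t]%classic) => //.
    by apply: subset_itvr; rewrite bnd_simp.
  apply: continuous_compact_integrable; first exact: segment_compact.
  by apply: continuous_subspaceT => x; exact: cvg_cst.
have cE c : \int[leb1]_(x in `]s, t]) (cst c x) = (t - s) * c.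
  rewrite Rintegral_cst//= lebesgue_measure_itv/= lte_fin mulrC.
  have [_|ts] := ltP s t; first by rewrite -EFinB.
  by have -> : t = s by [apply/eqP; rewrite eq_le st ts]; rewrite subrr.
rewrite -!cE; apply/andP; split; apply: le_Rintegral => // x /=;
  rewrite in_itv/= => /andP[sx xt]; apply: gam_homo => //.
- exact: ltW.
- by rewrite (le_trans s0)// ltW.
Qed.

Let G0 : G 0 = 0.
Proof. by rewrite GE normr0 set_itv1 Rintegral_set1. Qed.

Let GN t : G (- t) = G t. Proof. by rewrite /G normrN. Qed.

Let Gabs t : G `|t| = G t. Proof. by rewrite /G normr_id. Qed.

Let Gge0 t : 0 <= G t.
Proof.
rewrite -Gabs; have /andP[+ _] := G_diff (lexx 0) (normr_ge0 t).
by rewrite gam0 mulr0 G0 subr0.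
Qed.

Let G_homo s t : 0 <= s -> s <= t -> G s <= G t.
Proof.
move=> s0 st; have /andP[+ _] := G_diff s0 st.
have := mulr_ge0 (_ : 0 <= t - s) (gam_ge0 s0).
rewrite subr_ge0 => /(_ st); lra.
Qed.

Let subgrad_pos d d' : 0 <= d -> 0 <= d' -> G d + gam d * (d' - d) <= G d'.
Proof.
move=> d0 d'0; have [dd|/ltW dd] := leP d d'.
  by have /andP[+ _] := G_diff d0 dd; rewrite mulrC; lra.
have /andP[_] := G_diff d'0 dd; rewrite mulrC.
have -> : gam d * (d' - d) = - (gam d * (d - d')) by ring.
lra.
Qed.

Let subgrad_posl d d' : 0 <= d -> G d + gam d * (d' - d) <= G d'.
Proof.
move=> d0; have [d'0|/ltW d'0] := leP 0 d'; first exact: subgrad_pos.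
rewrite -[leRHS]GN; apply: (le_trans _ (subgrad_pos d0 (_ : 0 <= - d'))); last by rewrite oppr_ge0.
rewrite lerD2l ler_wpM2l ?gam_ge0//; lra.
Qed.

Let subgrad d d' : G d + gam d * (d' - d) <= G d'.
Proof.
have [d0|/ltW d0] := leP 0 d; first exact: subgrad_posl.
have := @subgrad_posl (- d) (- d'); rewrite !GN gam_odd oppr_ge0 => /(_ d0).
by have -> : - gam d * (- d' - - d) = gam d * (d' - d) by ring.
Qed.

Let G_gt0 t : 0 < t -> 0 < G t.
Proof.
move=> t0; rewrite lt0r Gge0 andbT; apply/eqP => Gt.
(* If [G t] vanished, the quotient in [G_growth] would be 0, since [0^-1 = 0], against [1 < gm]. *)
have := G_growth t0; rewrite Gt invr0 mulr0 => /andP[h _].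
by move: gm_gt1; rewrite ltNge (le_trans h) ?ler01.
Qed.

Let gp0 : 0 < gp.
Proof.
by have /andP[h1 h2] := G_growth ltr01; apply: lt_trans ltr01 (lt_le_trans gm_gt1 (le_trans h1 h2)).
Qed.

(** Chosen so that [delta * gp = 1/2]: the increment of [G] over one step is then at most half of
    its value at the end of the step. *)
Let delta := (2 * gp)^-1.

(* Growth at most [gp] bounds the doubling constant: [G] at most doubles from [t] to
   [(1 + delta) t], and finitely many such steps reach [2 t]. *)
Let G_step t : 0 <= t -> G ((1 + delta) * t) <= 2 * G t.
Proof.
rewrite le_eqVlt => /predU1P[<-|t0]; first by rewrite mulr0 G0 mulr0.
have d0 : 0 < delta by rewrite invr_gt0 mulr_gt0.
set s := (1 + delta) * t.
have ts : t <= s by rewrite /s mulrDl mul1r lerDl mulr_ge0 // ltW.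
have s0 : 0 < s by apply: lt_le_trans ts.
have /andP[_] := G_diff (ltW t0) ts.
have -> : s - t = delta * t by rewrite /s; ring.
rewrite gam_pos ?(ltW s0)// => h.
have /andP[_] := G_growth s0; rewrite ler_pdivrMr ?G_gt0// => h2.
have h3 : delta * t * (a s * s) <= delta * (a s * s ^+ 2).
  have -> : delta * (a s * s ^+ 2) = delta * s * (a s * s) by ring.
  apply: ler_wpM2r; first by rewrite mulr_ge0 ?a_ge0 ?(ltW s0).
  by rewrite ler_pM2l.
have h4 : delta * (a s * s ^+ 2) <= delta * (gp * G s) by rewrite ler_pM2l.
have h5 : delta * (gp * G s) = G s / 2.
  by rewrite /delta; field; rewrite gt_eqF.
lra.
Qed.

Lemma young_of_density :
  young_pair (2 ^+ Num.bound (2 * gp)) G gam.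
Proof.
have d0 : 0 < delta by rewrite invr_gt0 mulr_gt0.
split => // t; rewrite -(Gabs (2 * t)) -(Gabs t) normrM ger0_norm//.
move: `|t| (normr_ge0 t) => {}t t0.
set n := Num.bound _.
have it k : G ((1 + delta) ^+ k * t) <= 2 ^+ k * G t.
  elim: k => [|k ih]; first by rewrite !expr0 !mul1r.
  rewrite !exprS -!mulrA; apply: le_trans (G_step _) _.
    by rewrite mulr_ge0// exprn_ge0// addr_ge0// ltW.
  by rewrite ler_wpM2l.
apply: le_trans (it n); apply: G_homo; first by rewrite mulr_ge0.
apply: ler_wpM2r => //.
have hn : 2 * gp <= n%:R by rewrite ltW// archi_boundP// mulr_ge0// ltW.
have : 1 <= delta * n%:R by rewrite /delta mulrC ler_pdivlMr ?mul1r// mulr_gt0.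
(* Bernoulli's inequality; with [delta * n >= 1] it gives [(1 + delta)^n >= 2]. *)
suff : forall k, 1 + delta * k%:R <= (1 + delta) ^+ k by move=> /(_ n); lra.
elim=> [|k ih]; first by rewrite mulr0 addr0 expr0.
rewrite exprS -natr1.
apply: le_trans (_ : (1 + delta) * (1 + delta * k%:R) <= _); last first.
  by rewrite ler_wpM2l// addr_ge0// ltW.
have : 0 <= delta * (delta * k%:R) by rewrite !mulr_ge0// ltW.
lra.
Qed.

End young_of_density.

(** * Lebesgue measure on R^N *)

Section lebesgue_rV_positive.
Context {R : realType}.
Local Open Scope ereal_scope.
Local Notation leb1 := (@lebesgue_measure R).

Let len (a b : R) := Num.max 0%R (b - a)%R.

Let len_ge0 a b : (0 <= len a b)%R.
Proof. by rewrite le_max lexx. Qed.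

Let leb1_itv a b : leb1 `]a, b]%classic = (len a b)%:E.
Proof.
rewrite lebesgue_measure_itv/= lte_fin /len; case: ltP => ab.
  by rewrite -EFinB; congr EFin; apply/esym/max_idPr; rewrite subr_ge0 ltW.
by congr EFin; apply/esym/max_idPl; rewrite subr_le0.
Qed.

(* Induction on the dimension: the slices at height [t] of a cover cover the
   slice, and integrating over [t] adds the last factor to both sides. *)
Lemma box_volume_le_cover N (a b : nat -> R) (P : nat -> bool) (A B : nat -> nat -> R) :
  (forall x : nat -> R, (forall i, (i < N)%N -> (a i < x i <= b i)%R) ->
    exists k, P k /\ forall i, (i < N)%N -> (A k i < x i <= B k i)%R) ->
  (\prod_(i < N) len (a i) (b i))%:E <=
  \sum_(k <oo) (if P k then (\prod_(i < N) len (A k i) (B k i))%R else 0%R)%:E.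
Proof.
elim: N P => [|N ih] P cov.
  have [k [Pk _]] : exists k, P k /\ forall i, (i < 0)%N -> (A k i < a i <= B k i)%R.
    exact: cov.
  rewrite big_ord0; under eq_eseriesr do rewrite big_ord0.
  rewrite (@nneseriesD1 _ _ k)//; last by move=> n _; case: (P n).
  by rewrite Pk leeDl//; apply: nneseries_ge0 => n _ _; case: (P n).
pose c (k : nat) : R := if P k then (\prod_(i < N) len (A k i) (B k i))%R else 0%R.
have c0 k : (0 <= c k)%R by rewrite /c; case: (P k) => //; exact: prodr_ge0.
pose J k := `]A k N, B k N]%classic.
have mJ (k : nat) : measurable (J k : set R) by apply: measurable_itv.
have slice t : (a N < t <= b N)%R ->
    (\prod_(i < N) len (a i) (b i))%:E <= \sum_(k <oo) (c k * \1_(J k) t)%:E.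
  (* The slice at height [t] keeps the boxes whose last side contains [t]; the induction hypothesis
     is applied to these. *)
  move=> tab; pose P' k := P k && (t \in J k).
  have cE k : (c k * \1_(J k) t)%R =
      (if P' k then (\prod_(i < N) len (A k i) (B k i))%R else 0%R).
    by rewrite /P' /c indicE; case: (P k); case: (t \in J k);
       rewrite ?mulr1 ?mulr0 ?mul0r.
  under eq_eseriesr do rewrite cE.
  apply: ih => x xab.
  have [i|k [Pk kx]] := cov (fun i => if i == N then t else x i).
    rewrite ltnS leq_eqVlt => /predU1P[->|iN]; first by rewrite eqxx.
    by rewrite (ltn_eqF iN) xab.
  exists k; split.
    rewrite /P' Pk/= inE /J/= in_itv/=; have := kx N (ltnSn N); by rewrite eqxx.
  move=> i iN; have := kx i (ltnW iN); by rewrite ltn_eqF.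
rewrite big_ord_recr/= EFinM -leb1_itv.
have mc k : measurable_fun `]a N, b N]%classic (fun t => (c k * \1_(J k) t)%:E).
  by apply/measurable_EFinP/measurable_funM => //; apply: measurable_funTS;
     apply: measurable_indic; exact: mJ.
have cJ0 k t : 0 <= (c k * \1_(J k) t)%:E.
  by rewrite lee_fin mulr_ge0// indicE.
rewrite -integral_cst//.
apply: (@le_trans _ _ (\int[leb1]_(t in `]a N, b N]) \sum_(k <oo) (c k * \1_(J k) t)%:E)).
  apply: ge0_le_integral => //.
  - by move=> t _; rewrite lee_fin prodr_ge0.
  - by apply: (@ge0_emeasurable_sum _ _ _ _ _ xpredT) => [k x _ _|k _]; [exact: cJ0|exact: mc].
rewrite integral_nneseries//; apply: lee_nneseries => [k _ _|k _].
  by apply: integral_ge0 => t _.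
under eq_integral do rewrite EFinM.
rewrite ge0_integralZl_EFin//; last first.
  apply/measurable_EFinP; apply: measurable_funTS; apply: measurable_indic; exact: mJ.
rewrite integral_indic//; last exact: mJ.
apply: (@le_trans _ _ ((c k)%:E * (len (A k N) (B k N))%:E)).
  rewrite lee_wpmul2l ?lee_fin// -leb1_itv; apply: le_measure; rewrite ?inE.
  - by apply: measurableI => //; exact: mJ.
  - exact: mJ.
  - exact: subIsetl.
rewrite -EFinM lee_fin /c; case: (P k); first by rewrite big_ord_recr.
by rewrite mul0r.
Qed.

End lebesgue_rV_positive.

(** * Measurability of open sets and of continuous functions *)

Section lebesgue_rV_topology.
Context {R : realType} {N : nat}.
Local Notation vec := 'rV[R]_N.
Local Notation X := (lebesgue_rV_type R N).
Local Notation leb := (lebesgue_rV R N).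

(** Coordinates as a sequence padded with 0, to fit the covering lemma, whose induction runs over
    the dimension. *)
Let ext (v : vec) (i : nat) : R := oapp (fun j : 'I_N => v 0 j) 0 (insub i).

Let extE (v : vec) (j : 'I_N) : ext v j = v 0 j.
Proof. by rewrite /ext valK. Qed.

Lemma lebesgue_rV_box (a b : vec) :
  leb (box (Some (a, b))) = box_volume (Some (a, b)).
Proof.
apply/eqP; rewrite eq_le lebesgue_box_le andTb.
apply: le_ereal_inf_tmp => _ [c cov <-].
pose A k := if c k is Some ab then ext ab.1 else fun=> 0.
pose B k := if c k is Some ab then ext ab.2 else fun=> 0.
have -> : box_volume (Some (a, b)) =
    (\prod_(i < N) Num.max 0 (ext b i - ext a i))%:E.
  by congr EFin; apply: eq_bigr => i _; rewrite !extE.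
have cE k : box_volume (c k) =
    (if c k != None then \prod_(i < N) Num.max 0 (B k i - A k i) else 0)%:E.
  rewrite /A /B; case: (c k) => [[a' b']|]//; congr EFin; apply: eq_bigr => i _.
  by rewrite !extE.
under eq_eseriesr do rewrite cE.
apply: box_volume_le_cover => x xab.
have : box (Some (a, b)) (\row_i x i).
  by move=> i; rewrite mxE; have := xab i (ltn_ord i); rewrite !extE.
move=> /cov[k _]; case ck : (c k) => [[a' b']|]//= h.
exists k; rewrite /A /B ck; split => // i iN /=.
by have := h (Ordinal iN); rewrite mxE -!extE.
Qed.

Lemma open_nbhs_rat_box (U : set vec) (x : vec) : nbhs x U ->
  exists q : 'rV[rat]_N * 'rV[rat]_N,
    box (Some (map_mx ratr q.1, map_mx ratr q.2)) x /\
    box (Some (map_mx ratr q.1, map_mx ratr q.2)) `<=` U.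
Proof.
move=> /nbhs_ballP[e /= e0 eU].
have hl i : exists q : rat, ratr q \in `]x 0 i - e / 2, x 0 i[.
  by have [q] := @rat_in_itvoo R (x 0 i - e / 2) (x 0 i) ltac:(lra); exists q.
have hr i : exists q : rat, ratr q \in `]x 0 i, x 0 i + e / 2[.
  by have [q] := @rat_in_itvoo R (x 0 i) (x 0 i + e / 2) ltac:(lra); exists q.
have [l lP] := choice hl; have [r rP] := choice hr.
exists (\row_i l i, \row_i r i); split => [i|y yB].
  rewrite !mxE; have := lP i; have := rP i; rewrite !in_itv/=.
  by move=> /andP[/ltW -> _] /andP[_ ->].
apply: eU; split => // i j; rewrite (ord1 i).
have := yB j; have := lP j; have := rP j; rewrite !mxE !in_itv/= /ball/=.
by move=> /andP[? ?] /andP[? ?] /andP[? ?]; rewrite ltr_norml; apply/andP; split; lra.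
Qed.

Lemma open_measurable_rV (U : set vec) : open U -> measurable (U : set X).
Proof.
move=> oU.
have -> : U = \bigcup_(q : 'rV[rat]_N * 'rV[rat]_N) (U `&` [set x |
    box (Some (map_mx ratr q.1, map_mx ratr q.2)) x /\
    box (Some (map_mx ratr q.1, map_mx ratr q.2)) `<=` U]).
  apply/seteqP; split => [x Ux|x [q _ []]//].
  have [q qP] := open_nbhs_rat_box (open_nbhs_nbhs (conj oU Ux)).
  by exists q.
apply: countable_bigcupT_measurable => // q.
have [qU|qU] := pselect (box (Some (map_mx ratr q.1, map_mx ratr q.2)) `<=` U).
  rewrite (_ : _ `&` _ = box (Some (map_mx ratr q.1, map_mx ratr q.2))).
    exact: measurable_box.
  by apply/seteqP; split => [x [_ []]//|x qx]; split => //; exact: qU.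
by rewrite (_ : _ `&` _ = set0)//; apply/seteqP; split => [x [_ []]|].
Qed.

(** The sigma-algebra on pairs is the product of the Lebesgue ones, so [W] has to be exhausted by
    countably many measurable rectangles. *)
Lemma open_measurable_rVX (W : set (vec * vec)) : open W ->
  measurable (W : set (X * X)).
Proof.
move=> oW.
pose B (q : 'rV[rat]_N * 'rV[rat]_N) : set X := box (Some (map_mx ratr q.1, map_mx ratr q.2)).
have -> : W = \bigcup_(q : ('rV[rat]_N * 'rV[rat]_N) * ('rV[rat]_N * 'rV[rat]_N))
    (W `&` [set x | (B q.1 `*` B q.2) x /\ B q.1 `*` B q.2 `<=` W]).
  apply/seteqP; split => [[x y] Wxy|x [q _ []]//].
  have [[U V] /= [Ux Vy] UVW] := open_nbhs_nbhs (conj oW Wxy).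
  have [q [qx qU]] := open_nbhs_rat_box Ux.
  have [q' [qy qV]] := open_nbhs_rat_box Vy.
  exists (q, q') => //; split => //; split => //= -[x' y'] [/= qx' qy'].
  by apply: UVW; split => /=; [exact: qU|exact: qV].
apply: countable_bigcupT_measurable => // q.
have [qW|qW] := pselect (B q.1 `*` B q.2 `<=` W).
  rewrite (_ : _ `&` _ = B q.1 `*` B q.2).
    by apply: measurableX; exact: measurable_box.
  by apply/seteqP; split => [x [_ []]//|x qx]; split => //; exact: qW.
by rewrite (_ : _ `&` _ = set0)//; apply/seteqP; split => [x [_ []]|].
Qed.

Lemma open_preimage_continuous_at (T : topologicalType) (D : set T) (f : T -> R)
    (V : set R) : open D -> (forall x, D x -> {for x, continuous f}) ->
  open V -> open (D `&` f @^-1` V).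
Proof.
move=> oD cf oV; rewrite openE => x [Dx Vfx].
apply: filterI; first exact: open_nbhs_nbhs.
by apply: (cf _ Dx); exact: open_nbhs_nbhs.
Qed.

Lemma continuous_measurable_rV (D : set vec) (f : vec -> R) : open D ->
  (forall x, D x -> {for x, continuous f}) -> measurable_fun (D : set X) (f : X -> R).
Proof.
move=> oD cf; apply: (measurability _ (RGenOpens.measurableE R)).
move=> _ [_ [a [b ->] <-]]; apply: open_measurable_rV.
by apply: open_preimage_continuous_at => //; exact: interval_open.
Qed.

Lemma continuous_measurable_rVX (D : set (vec * vec)) (f : vec * vec -> R) :
  open D -> (forall x, D x -> {for x, continuous f}) ->
  measurable_fun (D : set (X * X)) (f : X * X -> R).
Proof.
move=> oD cf; apply: (measurability _ (RGenOpens.measurableE R)).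
move=> _ [_ [a [b ->] <-]]; apply: open_measurable_rVX.
by apply: open_preimage_continuous_at => //; exact: interval_open.
Qed.

Lemma continuous_at_within_closure (D : set vec) (f : vec -> R) : open D ->
  {within closure D, continuous f} -> forall x, D x -> {for x, continuous f}.
Proof.
move=> oD cf x Dx.
have : {within D, continuous f}.
  by apply: continuous_subspaceW cf; exact: subset_closure.
by rewrite continuous_open_subspace// => /(_ x); apply; rewrite inE.
Qed.

(** A small half-open cube with upper corner [x], whose measure is its volume, fits into [U]. This
    is what makes a function that is positive on [Omega] nontrivial. *)
Lemma open_lebesgue_rV_gt0 (U : set vec) : open U -> U !=set0 -> (0 < leb U)%E.
Proof.
move=> oU [x Ux].
have [e /= e0 eU] := (nbhs_ballP _ _).1 (open_nbhs_nbhs (conj oU Ux)).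
set B := box (Some (x - const_mx (e / 2), x)).
have BU : B `<=` U.
  move=> y yB; apply: eU; split => // i j; rewrite (ord1 i).
  have := yB j; rewrite !mxE /ball/= => /andP[? ?].
  by rewrite ltr_norml; apply/andP; split; lra.
have : (leb B <= leb U)%E.
  by apply: le_measure => //; rewrite inE; [exact: measurable_box|exact: open_measurable_rV].
apply: lt_le_trans; rewrite lebesgue_rV_box/= lte_fin; apply: prodr_gt0 => i _.
by rewrite !mxE lt_max; apply/orP; right; lra.
Qed.

Lemma bounded_lebesgue_rV_lty (U : set vec) : open U -> bounded_set U -> (leb U < +oo)%E.
Proof.
move=> oU [M [_ MU]].
pose K := `|M| + 1.
have UK x : U x -> `|x| <= K.
  move=> Ux; apply: (MU K) => //.
  by rewrite /K (le_lt_trans (ler_norm M))// ltrDl.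
have UB : U `<=` box (Some (const_mx (- (K + 1)), const_mx (K + 1))).
  move=> x Ux i; rewrite !mxE.
  have h : `|x 0 i| <= K.
    apply: le_trans (UK _ Ux).
    by rewrite [leRHS]/Num.norm/= mx_normrE; apply/bigmax_geP; right; exists (0, i).
  by move: h; rewrite ler_norml => /andP[? ?]; apply/andP; split; lra.
apply: (@le_lt_trans _ _ (leb (box (Some (const_mx (- (K + 1)), const_mx (K + 1)))))).
  by apply: le_measure => //; rewrite inE; [exact: open_measurable_rV|exact: measurable_box].
by rewrite lebesgue_rV_box/= ltry.
Qed.

End lebesgue_rV_topology.

(** * Modulars of Young functions *)

Section young_modular.
Context d (T : measurableType d) (R : realType) (mu : {measure set T -> \bar R}).
Context (D : set T) (mD : measurable D) (K : R) (K0 : 0 <= K).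
Context (G gam : T -> R -> R) (w : T -> R).
Context (Y : forall z, D z -> young_pair K (G z) (gam z)).
Context (mG : forall t, measurable_fun D (G^~ t)).
Context (w0 : forall z, D z -> 0 <= w z) (mw : measurable_fun D w).

Implicit Types f g : T -> R.

(** Used twice: on [Omega] with weight 1, and on pairs with the weight [mu_density]. *)
Definition young_modular (f : T -> R) : \bar R :=
  (\int[mu]_(z in D) (G z (f z) * w z)%:E)%E.

(* By monotonicity and continuity in [|t|], [c < G z (f z)] holds iff [c < G z q] for
   some rational [q < |f z|]. *)
Lemma measurable_young_comp f : measurable_fun D f ->
  measurable_fun D (fun z => G z (f z)).
Proof.
move=> mf; apply: (measurability _ (RGenOInfty.measurableE R)).
move=> _ [_ [c ->] <-].
have [c0|c0] := ltP c 0.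
  rewrite (_ : _ `&` _ = D)//; apply/seteqP; split => [z []//|z Dz]; split => //=.
  by rewrite in_itv/= andbT (lt_le_trans c0)// (young_ge0 (Y Dz)).
have -> : D `&` (fun z => G z (f z)) @^-1` `]c, +oo[ =
    \bigcup_(q : rat) (if 0 <= q then (D `&` [set z | c < G z (ratr q)]) `&`
      (D `&` [set z | ratr q < `|f z|]) else set0).
  apply/seteqP; split => [z [Dz /=]|z [q _]]; last first.
    case: ifPn => // q0 [[Dz /= cq] [_ /= qf]]; split => //=.
    rewrite in_itv/= andbT (lt_le_trans cq)// (young_le (Y Dz))//.
    by rewrite ger0_norm ?ler0q// ltW.
  rewrite in_itv/= andbT -(young_norm (Y Dz)) => cG.
  have fz0 : 0 < `|f z|.
    rewrite lt0r normr_ge0 andbT; apply: contraTneq cG => ->.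
    by rewrite (young0 (Y Dz)) -leNgt.
  have : \forall x \near `|f z|, c < G z x.
    by have := @young_continuous _ _ _ _ (Y Dz) `|f z|; move/cvgr_gt; apply.
  move=> /nbhs_ballP[e /= e0 eG].
  have lt_m : Num.max 0 (`|f z| - e) < `|f z| by rewrite gt_max fz0; lra.
  have [q] := rat_in_itvoo lt_m.
  rewrite in_itv/= gt_max => /andP[/andP[q0 qe] qf].
  exists q => //; rewrite -(ler0q R) (ltW q0); split; split => //=.
  by apply: eG; rewrite /ball/= ger0_norm; lra.
apply: countable_bigcupT_measurable => // q.
case: ifPn => // q0; apply: measurableI.
  rewrite (_ : _ `&` _ = D `&` (G^~ (ratr q)) @^-1` `]c, +oo[).
    by apply: mG => //; exact: measurable_itv.
  by apply/seteqP; split => z []Dz /=; rewrite in_itv/= andbT => ?; split.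
rewrite (_ : _ `&` _ = D `&` (fun z => `|f z|) @^-1` `]ratr q, +oo[).
  have mnf : measurable_fun D (fun z => `|f z|) by exact: measurableT_comp.
  by apply: mnf => //; exact: measurable_itv.
by apply/seteqP; split => z []Dz /=; rewrite in_itv/= andbT => ?; split.
Qed.

(** [gam] is the pointwise limit of difference quotients of [G] in the direction 1, so measurability
    is inherited. *)
Lemma measurable_young_grad_comp f : measurable_fun D f ->
  measurable_fun D (fun z => gam z (f z)).
Proof.
move=> mf.
apply: (@measurable_fun_cvg _ _ _ _
  (fun (n : nat) z => n.+1%:R * (G z (f z + 1 / n.+1%:R) - G z (f z)))) => [n|z Dz].
  apply: measurable_funM => //; apply: measurable_funB.
    by apply: measurable_young_comp; exact: measurable_funD.
  exact: measurable_young_comp.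
by have := @young_diff_quotient_cvg _ _ _ _ (Y Dz) (f z) 1; rewrite mulr1.
Qed.

Lemma young_integrand_ge0 f z : D z -> 0 <= G z (f z) * w z.
Proof. by move=> Dz; rewrite mulr_ge0 ?w0// (young_ge0 (Y Dz)). Qed.

Lemma measurable_young_integrand f : measurable_fun D f ->
  measurable_fun D (fun z => (G z (f z) * w z)%:E).
Proof.
by move=> mf; apply/measurable_EFinP/measurable_funM => //; exact: measurable_young_comp.
Qed.

Lemma young_modular_ge0 f : (0 <= young_modular f)%E.
Proof. by apply: integral_ge0 => z Dz; rewrite lee_fin young_integrand_ge0. Qed.

Lemma le_young_modular f g : measurable_fun D f -> measurable_fun D g ->
  (forall z, D z -> `|f z| <= `|g z|) -> (young_modular f <= young_modular g)%E.
Proof.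
move=> mf mg fg; apply: ge0_le_integral => //.
- by move=> z Dz; rewrite lee_fin young_integrand_ge0.
- exact: measurable_young_integrand.
- exact: measurable_young_integrand.
- by move=> z Dz; rewrite lee_fin ler_wpM2r ?w0// (young_le (Y Dz))// fg.
Qed.

(** Since [|c| <= 2^n] for some [n], iterated doubling applies. In the definition of the spaces,
    finiteness for some [lambda] thus amounts to finiteness for all. *)
Lemma young_modular_scale_lty (c : R) f : measurable_fun D f ->
  (young_modular f < +oo)%E -> (young_modular (fun z => (c * f z)%R) < +oo)%E.
Proof.
move=> mf fy; pose n := Num.bound `|c|.
have h z : D z -> G z (c * f z) * w z <= K ^+ n * (G z (f z) * w z).
  move=> Dz; rewrite mulrA ler_wpM2r ?w0//.
  apply: le_trans (young_scale_pow (Y Dz) _ _ K0).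
  rewrite (young_le (Y Dz))// !normrM ler_wpM2r//.
  apply: (le_trans (ltW (archi_boundP (normr_ge0 c)))).
  rewrite ger0_norm ?exprn_ge0// -natrX ler_nat.
  by apply: ltnW; apply: ltn_expl.
apply: (@le_lt_trans _ _ ((K ^+ n)%:E * young_modular f)%E).
  rewrite -ge0_integralZl_EFin ?exprn_ge0//; last 2 first.
  - by move=> z Dz; rewrite lee_fin young_integrand_ge0.
  - exact: measurable_young_integrand.
  apply: ge0_le_integral => //.
  - by move=> z Dz; rewrite lee_fin (young_integrand_ge0 (fun z => c * f z)).
  - by apply: measurable_young_integrand; exact: measurable_funM.
  - by apply: measurable_funeM; exact: measurable_young_integrand.
by rewrite lte_mul_pinfty// ?lee_fin ?exprn_ge0.
Qed.

Lemma young_modular_scale_ltyP (c : R) f : c != 0 -> measurable_fun D f ->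
  (young_modular (fun z => (c * f z)%R) < +oo)%E -> (young_modular f < +oo)%E.
Proof.
move=> c0 mf h.
have -> : f = (fun z => c^-1 * (c * f z)) by apply/funext => z; rewrite mulKf.
by apply: young_modular_scale_lty => //; exact: measurable_funM.
Qed.

Lemma young_modularD_lty f g : measurable_fun D f -> measurable_fun D g ->
  (young_modular f < +oo)%E -> (young_modular g < +oo)%E ->
  (young_modular (fun z => (f z + g z)%R) < +oo)%E.
Proof.
move=> mf mg fy gy.
have mfg : measurable_fun D (fun z => f z + g z) by exact: measurable_funD.
apply: (@le_lt_trans _ _ (K%:E * (young_modular f + young_modular g))%E); last first.
  by rewrite lte_mul_pinfty ?lee_fin// lte_add_pinfty.
rewrite -ge0_integralD//; [|by move=> z Dz; rewrite lee_fin young_integrand_ge0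
  |exact: measurable_young_integrand
  |by move=> z Dz; rewrite lee_fin young_integrand_ge0
  |exact: measurable_young_integrand].
rewrite -ge0_integralZl_EFin//.
- apply: ge0_le_integral => //.
  + by move=> z Dz; rewrite lee_fin (young_integrand_ge0 (fun z => f z + g z)).
  + exact: measurable_young_integrand.
  + apply: measurable_funeM; apply: emeasurable_funD; exact: measurable_young_integrand.
  + move=> z Dz; rewrite -EFinD -EFinM lee_fin -mulrDl mulrA ler_wpM2r ?w0//.
    exact: (young_add (Y Dz)).
- by move=> z Dz; rewrite -EFinD lee_fin addr_ge0// young_integrand_ge0.
- by apply: emeasurable_funD; exact: measurable_young_integrand.
Qed.

Lemma young_modular_mid f g : measurable_fun D f -> measurable_fun D g ->
  (2%:E * young_modular (fun z => ((f z + g z) / 2)%R) <=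
   young_modular f + young_modular g)%E.
Proof.
move=> mf mg.
have mh : measurable_fun D (fun z => (f z + g z) / 2).
  by apply: measurable_funM => //; exact: measurable_funD.
rewrite -ge0_integralD//; [|by move=> z Dz; rewrite lee_fin young_integrand_ge0
  |exact: measurable_young_integrand
  |by move=> z Dz; rewrite lee_fin young_integrand_ge0
  |exact: measurable_young_integrand].
rewrite -ge0_integralZl_EFin//; last 2 first.
- by move=> z Dz; rewrite lee_fin (young_integrand_ge0 (fun z => (f z + g z) / 2)).
- exact: measurable_young_integrand.
apply: ge0_le_integral => //.
- move=> z Dz; rewrite -EFinM lee_fin mulr_ge0//.
  exact: (young_integrand_ge0 (fun z => (f z + g z) / 2)).
- by apply: measurable_funeM; exact: measurable_young_integrand.
- by apply: emeasurable_funD; exact: measurable_young_integrand.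
- move=> z Dz; rewrite -EFinD -EFinM lee_fin -mulrDl mulrA ler_wpM2r ?w0//.
  by have := young_mid (Y Dz) (f z) (g z); lra.
Qed.

Lemma young_modular_lsc (f_ : nat -> T -> R) f (N : set T) :
  (forall n, measurable_fun D (f_ n)) -> measurable_fun D f ->
  measurable N -> mu N = 0%E ->
  (forall z, D z -> ~ N z -> f_ n z @[n --> \oo] --> f z) ->
  (young_modular f <= limn_einf (fun n => young_modular (f_ n)))%E.
Proof.
move=> mf_ mf mN N0 cf.
have rm g : measurable_fun D g ->
    young_modular g = (\int[mu]_(z in D `\` N) (G z (g z) * w z)%:E)%E.
  move=> mg; apply: ge0_negligible_integral => //; first exact: measurable_young_integrand.
  by move=> z Dz; rewrite lee_fin young_integrand_ge0.
rewrite rm//.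
rewrite [X in limn_einf X](_ : _ = (fun n =>
    (\int[mu]_(z in D `\` N) (G z (f_ n z) * w z)%:E)%E)); last first.
  by apply/funext => n; rewrite rm.
have mDN : measurable (D `\` N) by exact: measurableD.
have DN : D `\` N `<=` D by move=> z [].
apply: le_trans (fatou mu mDN _ _); last 2 first.
- by move=> n; apply: measurable_funS mD DN _; exact: measurable_young_integrand.
- by move=> n z [Dz _]; rewrite lee_fin young_integrand_ge0.
rewrite le_eqVlt; apply/orP; left; apply/eqP; apply: eq_integral => z.
rewrite inE => -[Dz Nz].
have : (G z (f_ n z) * w z)%:E @[n --> \oo] --> (G z (f z) * w z)%:E.
  apply: cvg_EFin; first exact: nearW.
  apply: cvgMr_tmp; apply: (cvg_comp _ _ (cf _ Dz Nz)).
  exact: (young_continuous (Y Dz)).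
by move/cvg_limn_einf_sup => [].
Qed.

(** * Directional derivative of a modular *)

Section gateaux.
Context (f e : T -> R) (mf : measurable_fun D f) (me : measurable_fun D e).
Context (fy : (young_modular f < +oo)%E) (ey : (young_modular e < +oo)%E).

Let quot (n : nat) z := n.+1%:R * (G z (f z + e z / n.+1%:R) - G z (f z)) * w z.
Let dom z := (G z (f z + e z) + G z (f z - e z)) * w z.
Let grad z := gam z (f z) * e z * w z.

Let young_modular_integrable g : measurable_fun D g -> (young_modular g < +oo)%E ->
  mu.-integrable D (fun z => (G z (g z) * w z)%:E).
Proof.
move=> mg gy; apply/integrableP; split; first exact: measurable_young_integrand.
apply: le_lt_trans gy; rewrite le_eqVlt; apply/orP; left; apply/eqP.
apply: eq_integral => z; rewrite inE => Dz.
by rewrite gee0_abs// lee_fin young_integrand_ge0.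
Qed.

Let mfe n : measurable_fun D (fun z => f z + e z / n.+1%:R).
Proof. by apply: measurable_funD => //; exact: measurable_funM. Qed.

Let fey n : (young_modular (fun z => (f z + e z / n.+1%:R)%R) < +oo)%E.
Proof.
apply: young_modularD_lty => //; first exact: measurable_funM.
by under eq_fun do rewrite mulrC; exact: young_modular_scale_lty.
Qed.

Let mquot n : measurable_fun D (fun z => (quot n z)%:E).
Proof.
apply/measurable_EFinP; apply: measurable_funM => //; apply: measurable_funM => //.
by apply: measurable_funB; apply: measurable_young_comp.
Qed.

Let mgrad : measurable_fun D (fun z => (grad z)%:E).
Proof.
apply/measurable_EFinP; apply: measurable_funM => //; apply: measurable_funM => //.
exact: measurable_young_grad_comp.
Qed.

Let idom : mu.-integrable D (fun z => (dom z)%:E).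
Proof.
under eq_fun do rewrite /dom mulrDl EFinD.
apply: integrableD => //; apply: young_modular_integrable.
- exact: measurable_funD.
- exact: young_modularD_lty.
- exact: measurable_funB.
- apply: young_modularD_lty => //; first exact: measurable_funN.
  under eq_fun do rewrite -mulN1r; exact: young_modular_scale_lty.
Qed.

(** The majorant [dom] is a sum of two modular integrands, at [f + e] and at [f - e]; both modulars
    are finite by doubling. *)
Let dct : [/\ mu.-integrable D (fun z => (grad z)%:E),
  [sequence \int[mu]_(z in D) `|(quot n z)%:E - (grad z)%:E|]_n @ \oo --> 0%E &
  [sequence \int[mu]_(z in D) (quot n z)%:E]_n @ \oo --> \int[mu]_(z in D) (grad z)%:E]%E.
Proof.
apply: (@dominated_convergence _ _ _ mu D mD _ _ (fun z => (dom z)%:E)) => //.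
- apply: aeW => z Dz; apply: cvg_EFin; first exact: nearW.
  by apply: cvgMr_tmp; exact: (young_diff_quotient_cvg (Y Dz)).
- apply: aeW => z n Dz; rewrite lee_fin /quot /dom normrM (ger0_norm (w0 Dz)).
  by rewrite ler_wpM2r ?w0// (young_diff_quotient_bound (Y Dz)).
Qed.

Lemma young_grad_integrable : mu.-integrable D (fun z => (gam z (f z) * e z * w z)%:E).
Proof. by case: dct. Qed.

Lemma young_modular_gateaux :
  n.+1%:R * (fine (young_modular (fun z => (f z + e z / n.+1%:R)%R)) -
             fine (young_modular f)) @[n --> \oo]
  --> \int[mu]_(z in D) (gam z (f z) * e z * w z).
Proof.
case: dct => ig _; rewrite -(fineK (integrable_fin_num mD ig)) => /fine_cvgP[_].
apply: cvg_trans; apply: near_eq_cvg; near=> n.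
rewrite /= /quot.
under eq_integral => z _ do rewrite -mulrA EFinM mulrBl EFinB.
rewrite integralZl//; last first.
  by apply: integrableB => //; exact: young_modular_integrable.
rewrite integralB//; try exact: young_modular_integrable.
have := fey n; have := young_modular_ge0 (fun z => f z + e z / n.+1%:R).
have := fy; have := young_modular_ge0 f; rewrite /young_modular.
case: (\int[mu]_(z in D) (G z (f z) * w z)%:E)%E => [x _ _|//|//].
by case: (\int[mu]_(z in D) _)%E.
Unshelve. all: by end_near. Qed.

End gateaux.

End young_modular.

(** * Limits and almost everywhere convergence *)

(** The power is [expR (g x * ln (f x))] off the zeros of [f]; at the zeros its value is 1 or 0
    according to whether [g x = 0], a separate measurable case. *)
Lemma measurable_fun_powR2 d (T : measurableType d) (R : realType) (D : set T)
    (f g : T -> R) : measurable_fun D f -> measurable_fun D g ->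
  measurable_fun D (fun x => f x `^ g x).
Proof.
move=> mf mg mD; rewrite /powR.
have mb (k : T -> R) : measurable_fun D k -> measurable_fun D (fun x => k x == 0).
  by move=> mk; apply: measurable_fun_eqr.
suff : measurable_fun D (fun x => if f x == 0 then (g x == 0)%:R else expR (g x * ln (f x))).
  exact.
apply: measurable_fun_if => //; first exact: mb.
- have mDI : measurable (D `&` (fun x => f x == 0) @^-1` [set true]) by exact: mb.
  have -> : (fun x => (g x == 0)%:R : R) = (fun x => if g x == 0 then 1 else 0).
    by apply/funext => x; case: (g x == 0).
  apply: measurable_fun_if => //.
  by apply: (measurable_funS mD) => [x []//|]; exact: mb.
- apply: measurableT_comp => //.
  apply: (measurable_funS mD) => [x []//|].
  by apply: measurable_funM => //; exact: measurableT_comp.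
Qed.

Lemma cvg_powR_base {R : realType} (u_ : nat -> R) (u b : R) :
  (forall n, 0 <= u_ n) -> 0 <= u -> 0 < b ->
  u_ n @[n --> \oo] --> u -> u_ n `^ b @[n --> \oo] --> u `^ b.
Proof.
move=> u_0; rewrite le_eqVlt => /predU1P[<-|u0] b0 cu.
  rewrite powR0 ?gt_eqF//; apply/cvgrPdist_le => e e0.
  have d0 : 0 < e `^ b^-1 by rewrite powR_gt0.
  near=> n; rewrite sub0r normrN ger0_norm ?powR_ge0//.
  have : `|0 - u_ n| <= e `^ b^-1 by near: n; move/cvgrPdist_le : cu; apply.
  rewrite sub0r normrN ger0_norm// => un.
  have -> : e = (e `^ b^-1) `^ b by rewrite -powRrM mulVf ?gt_eqF// powRr1// ltW.
  by apply: ge0_ler_powR; rewrite ?nnegrE ?powR_ge0 // ltW.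
have cb : {for u, continuous (@powR R ^~ b)}.
  apply: differentiable_continuous; apply/derivable1_diffP.
  by apply: derivable_powR; rewrite in_itv/= u0.
exact: (cvg_comp _ _ cu cb).
Unshelve. all: by end_near. Qed.

Section limn_einf_extra.
Context {R : realType}.
Local Open Scope ereal_scope.
Implicit Types a b : (\bar R)^nat.

Lemma le_limn_einf a b : (forall n, a n <= b n) -> limn_einf a <= limn_einf b.
Proof.
move=> ab; rewrite !limn_einf_lim; apply: lee_lim; [exact: is_cvg_einfs..|].
apply: nearW => n; apply: le_ereal_inf_tmp => _ [k /= nk <-].
by apply: le_trans (ab k); apply: ereal_inf_lbound; exists k.
Qed.

Lemma limn_einfD_ge a b : (forall n, 0 <= a n) -> (forall n, 0 <= b n) ->
  limn_einf a + limn_einf b <= limn_einf (fun n => a n + b n).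
Proof.
move=> a0 b0.
have e0 c : (forall n, 0 <= c n) -> forall n, 0 <= einfs c n.
  by move=> c0 n; apply: le_ereal_inf_tmp => _ [k _ <-].
have l0 c : (forall n, 0 <= c n) -> 0 <= limn (einfs c).
  by move=> c0; apply: lime_ge; [exact: is_cvg_einfs|apply: nearW; exact: e0].
rewrite !limn_einf_lim -limeD; [|exact: is_cvg_einfs..|]; last first.
  by rewrite ge0_adde_def// inE l0.
apply: lee_lim.
- by apply: is_cvgeD; [rewrite ge0_adde_def// inE l0|exact: is_cvg_einfs..].
- exact: is_cvg_einfs.
- apply: nearW => n; apply: le_ereal_inf_tmp => _ [k /= nk <-].
  by apply: leeD; apply: ereal_inf_lbound; exists k.
Qed.

Lemma limn_einf_le_cvg a (c : R) (e : nat -> R) :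
  (forall n, a n <= (c + e n)%:E) -> (e n @[n --> \oo] --> 0)%R ->
  limn_einf a <= c%:E.
Proof.
move=> ae e0; apply: (le_trans (le_limn_einf ae)).
have : (c + e n)%:E @[n --> \oo] --> c%:E.
  apply: cvg_EFin; first exact: nearW.
  by rewrite -[X in _ --> X]addr0; apply: cvgD => //; exact: cvg_cst.
by move/cvg_limn_einf_sup => [-> _].
Qed.

End limn_einf_extra.

(** By monotone convergence the sum of the increments is integrable, hence finite off a null set,
    and there the telescoping series converges absolutely. *)
Lemma ae_cvg_summable_increments d (T : measurableType d) (R : realType)
    (mu : {measure set T -> \bar R}) (D : set T) (v_ : nat -> T -> R) (r : R) :
  measurable D -> (forall n, measurable_fun D (v_ n)) ->
  (forall n, (\int[mu]_(x in D) `|v_ n.+1 x - v_ n x|%:E <=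
              (r / (2 ^ (n + 1))%:R)%:E)%E) ->
  exists N, [/\ measurable N, mu N = 0%E &
    forall x, D x -> ~ N x -> cvgn (v_ ^~ x)].
Proof.
move=> mD mv hv.
pose dv n x : R := `|v_ n.+1 x - v_ n x|.
have mdv n : measurable_fun D (EFin \o dv n).
  by apply/measurable_EFinP; apply: measurableT_comp => //; exact: measurable_funB.
pose S x := (\sum_(n <oo) (dv n x)%:E)%E.
have S0 x : (0 <= S x)%E by apply: nneseries_ge0 => n _ _; rewrite lee_fin normr_ge0.
have mS : measurable_fun D S.
  apply: (@ge0_emeasurable_sum _ _ _ _ (fun n => EFin \o dv n) xpredT).
  - by move=> n x _ _; rewrite lee_fin normr_ge0.
  - by move=> n _; exact: mdv.
have iS : mu.-integrable D S.
  apply/integrableP; split => //.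
  under eq_integral do rewrite gee0_abs//.
  rewrite integral_nneseries//; last by move=> n x _; rewrite lee_fin normr_ge0.
  apply: (@le_lt_trans _ _ (\sum_(n <oo) (r / (2 ^ (n + 1))%:R)%:E)%E).
    apply: lee_nneseries => [n _ _|n _]; last exact: hv.
    by apply: integral_ge0 => x _; rewrite lee_fin normr_ge0.
  rewrite (cvg_lim _ (@cvg_geometric_eseries_half _ r 0%N))//.
  exact: ltry.
have [N [mN N0 NP]] := integrable_ae mD iS.
exists N; split => // x Dx Nx.
have : S x \is a fin_num by apply: contrapT => h; apply: Nx; apply: NP => /= /(_ Dx).
move=> /fineK Sx.
have ser : cvgn (series (telescope (v_ ^~ x))).
  apply: normed_cvg; apply: nondecreasing_is_cvgn.
    by apply: nondecreasing_series => n _ _; rewrite normr_ge0.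
  exists (fine (S x)) => _ [n _ <-].
  rewrite -lee_fin Sx /series/= -sumEFin.
  by apply: nneseries_lim_ge => k _ _; rewrite lee_fin normr_ge0.
rewrite (_ : v_ ^~ x = (fun n => v_ 0%N x + series (telescope (v_ ^~ x)) n)); last first.
  by apply/funext => n; rewrite -eq_sum_telescope.
by apply: is_cvgD => //; exact: is_cvg_cst.
Qed.

(** Pointwise Cauchy-Schwarz with a free weight [l]. For [d >= 0], the right side minus the left one
    is [((l d - z)^2 + l d z) / (l z)]. *)
Lemma norm_le_amgm {R : realType} (d z l : R) : 0 < z -> 0 < l ->
  `|d| <= l * (d ^+ 2 / z) + z / l.
Proof.
move=> z0 l0; rewrite -(real_normK (num_real d)).
move: `|d| (normr_ge0 d) => {}d d0.
have : 0 <= ((l * d - z) ^+ 2 + l * d * z) / (l * z).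
  by rewrite divr_ge0 ?addr_ge0 ?sqr_ge0 ?mulr_ge0// ltW.
have -> : ((l * d - z) ^+ 2 + l * d * z) / (l * z) = l * (d ^+ 2 / z) + z / l - d.
  by field; rewrite !gt_eqF.
by rewrite subr_ge0.
Qed.

(** Written as the power with exponent -1, which agrees with the inverse even at 0, both being 0
    there. Such zeros occur: distances vanish on the diagonal. *)
Lemma measurable_funV_ge0 d (T : measurableType d) (R : realType) (D : set T)
    (f : T -> R) : measurable_fun D f -> (forall x, D x -> 0 <= f x) ->
  measurable_fun D (fun x => (f x)^-1).
Proof.
move=> mf f0; apply: (@eq_measurable_fun _ _ _ _ D (fun x => f x `^ (-1))).
  by move=> x /[1!inE] Dx; rewrite powR_inv1// f0.
exact: measurable_fun_powR2.
Qed.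

(** * The abstract singular problem *)

Section singular_problem.
Context d (T : measurableType d) (R : realType).
Context (mu : {sigma_finite_measure set T -> \bar R}).
Local Notation mu2 := (mu \x mu)%E.
Context (D : set T) (mD : measurable D) (muD : (mu D < +oo)%E).
Context (K : R) (K0 : 0 <= K).
Context (G1 g1 : T -> R -> R).
Context (Y1 : forall x, D x -> young_pair K (G1 x) (g1 x)).
Context (mG1 : forall t, measurable_fun D (G1^~ t)).
Context (G2 g2 : T * T -> R -> R).
Context (Y2 : forall z, (D `*` D) z -> young_pair K (G2 z) (g2 z)).
Context (mG2 : forall t, measurable_fun (D `*` D) (G2^~ t)).
Context (kap w : T * T -> R).
Context (mkap : measurable_fun (D `*` D) kap) (mw : measurable_fun (D `*` D) w).
Context (w0 : forall z, (D `*` D) z -> 0 <= w z).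
Context (h b : T -> R) (mh : measurable_fun D h) (mb : measurable_fun D b).
Context (h0 b0 b1 : R) (h0_gt0 : 0 < h0) (b0_gt0 : 0 < b0) (b1_lt1 : b1 < 1).
Context (h_ge : forall x, D x -> h0 <= h x).
Context (b_bnd : forall x, D x -> b0 <= b x <= b1).
Context (M C0 C2 : R) (M_gt0 : 0 < M) (C0_ge0 : 0 <= C0).
Context (G1_at1 : forall x, D x -> G1 x 1 <= C2).
Context (G1_growth : forall x t, D x -> 0 <= t -> t <= 1 + M * G1 x t).

Let H x t := h x / b x * t `^ b x.

Context (H_le : forall x t, D x -> 0 <= t -> H x t <= G1 x t / 2 + C0).

(** * The energy functional *)

Let D2 := D `*` D.
Let mD2 : measurable D2. Proof. exact: measurableX. Qed.

(* [kap] stands for [|x - y|^(-s(x,y))] and [w] for the density of [mu]. *)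
Let dq (u : T -> R) z := (u z.1 - u z.2) * kap z.
Let A (u : T -> R) := young_modular mu D G1 (cst 1) u.
Let B (u : T -> R) := young_modular mu2 D2 G2 w (dq u).
(* The constant [C0] makes [F >= G1 / 2 >= 0], so that Fatou's lemma applies to [Phi]. *)
Let F x t := G1 x t - H x t + C0.
Let adm (u : T -> R) := measurable_fun D u /\ forall x, D x -> 0 <= u x.
Let Phi (u : T -> R) := (\int[mu]_(x in D) (F x (u x))%:E)%E.
Let J u := (B u + Phi u)%E.
Let m1 : measurable_fun D (cst 1 : T -> R). Proof. exact: measurable_cst. Qed.
Let p1 x : D x -> 0 <= (cst 1 : T -> R) x. Proof. by []. Qed.

Let b01 x : D x -> 0 < b x < 1.
Proof.
by move=> /b_bnd /andP[lb ub]; rewrite (lt_le_trans b0_gt0 lb) (le_lt_trans ub b1_lt1).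
Qed.

Let hb_gt0 x : D x -> 0 < h x / b x.
Proof.
by move=> Dx; have /andP[? _] := b01 Dx; rewrite divr_gt0// (lt_le_trans h0_gt0)// h_ge.
Qed.

Let mdq u : measurable_fun D u -> measurable_fun D2 (dq u).
Proof.
move=> mu_; apply: measurable_funM => //; apply: measurable_funB.
  apply: (measurable_comp (F := D)) => //; first by move=> _ [z [? ?] <-].
  exact: measurable_funTS.
apply: (measurable_comp (F := D)) => //; first by move=> _ [z [? ?] <-].
exact: measurable_funTS.
Qed.

Let H_ge0 x t : D x -> 0 <= H x t.
Proof. by move=> Dx; rewrite mulr_ge0 ?powR_ge0// ltW// hb_gt0. Qed.

Let F_ge x t : D x -> 0 <= t -> G1 x t / 2 <= F x t.
Proof. by move=> Dx t0; have := H_le Dx t0; rewrite /F; lra. Qed.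

Let F_ge0 x t : D x -> 0 <= t -> 0 <= F x t.
Proof.
move=> Dx t0; apply: le_trans (F_ge Dx t0).
by rewrite divr_ge0// (young_ge0 (Y1 Dx)).
Qed.

Let F_lin x t : D x -> 0 <= t -> t <= 1 + 2 * M * F x t.
Proof.
move=> Dx t0; apply: (le_trans (G1_growth Dx t0)); rewrite lerD2l.
have := F_ge Dx t0; rewrite -(ler_pM2l M_gt0); lra.
Qed.

(** * Convexity gap of the energy *)

Let q s t : R := (Num.sqrt s - Num.sqrt t) ^+ 2 / (1 + (s + t) / 2).

Let q_ge0 s t : 0 <= s -> 0 <= t -> 0 <= q s t.
Proof. by move=> s0 t0; rewrite divr_ge0 ?sqr_ge0//; lra. Qed.

(** Lower bound on [D] for the coefficient [h / b] times the factor [b (1 - b) / 2] of the scalar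
    gap. *)
Let kap0 := h0 * (1 - b1) / 2.

Let kap0_gt0 : 0 < kap0.
Proof. by rewrite /kap0 divr_gt0// mulr_gt0// subr_gt0. Qed.

(** The Young part contributes a nonnegative gap; the term with [q] is due to the strict concavity
    of [H x]. *)
Let F_gap x s t : D x -> 0 <= s -> 0 <= t ->
  2 * F x ((s + t) / 2) + kap0 * q s t <= F x s + F x t.
Proof.
move=> Dx s0 t0.
have g := young_mid (Y1 Dx) s t.
have /andP[bx0 bx1] := b01 Dx.
have k := powR_midpoint_gap s0 t0 (b01 Dx); rewrite -/(q s t) in k.
have hb := hb_gt0 Dx.
have : kap0 * q s t <= h x / b x * (2 * ((s + t) / 2) `^ b x - s `^ b x - t `^ b x).
  rewrite -(ler_pM2l hb) in k; apply: le_trans k.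
  have -> : h x / b x * (b x * (1 - b x) / 2 * q s t) = h x * (1 - b x) / 2 * q s t.
    by field; rewrite gt_eqF.
  apply: ler_wpM2r; first exact: q_ge0.
  rewrite /kap0 ler_pM2r//; apply: ler_pM; [exact: ltW| |exact: h_ge|].
    by rewrite subr_ge0 ltW.
  by have /andP[_ ?] := b_bnd Dx; rewrite lerB.
rewrite /F /H; lra.
Qed.

Let mH u : measurable_fun D u -> measurable_fun D (fun x => H x (u x)).
Proof.
move=> mu_; apply: measurable_funM; last exact: measurable_fun_powR2.
apply: measurable_funM => //.
by apply: measurable_funV_ge0 => // x /b01 /andP[/ltW].
Qed.

Let mF u : measurable_fun D u -> measurable_fun D (fun x => (F x (u x))%:E).
Proof.
move=> mu_; apply/measurable_EFinP; apply: measurable_funD => //.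
apply: measurable_funB; last exact: mH.
exact: (measurable_young_comp mD Y1 mG1).
Qed.

Let B_ge0 u : (0 <= B u)%E.
Proof. exact: (young_modular_ge0 mu2 Y2 w0). Qed.

Let Phi_ge0 u : adm u -> (0 <= Phi u)%E.
Proof.
move=> [mu_ u0]; apply: integral_ge0 => x Dx; rewrite lee_fin.
by apply: F_ge0 => //; exact: u0.
Qed.

Let J_ge0 u : adm u -> (0 <= J u)%E.
Proof. by move=> au; rewrite /J adde_ge0 ?B_ge0 ?Phi_ge0. Qed.

Let adm0 : adm (cst 0).
Proof. by split => //; exact: measurable_cst. Qed.

Let J0 : (J (cst 0%R) < +oo)%E.
Proof.
apply: lte_add_pinfty.
  rewrite /B /young_modular integral0_eq ?ltry// => z Dz.
  by rewrite /dq subrr mul0r (young0 (Y2 Dz)) mul0r.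
rewrite /Phi (eq_integral (cst C0%:E)).
  by rewrite integral_cst// lte_mul_pinfty// lee_fin.
move=> x; rewrite inE => Dx; congr EFin.
have /andP[bx _] := b01 Dx.
by rewrite /F /H powR0 ?gt_eqF// mulr0 (young0 (Y1 Dx)) subr0 add0r.
Qed.

Let I := ereal_inf [set J u | u in adm].

Let I_fin : I \is a fin_num.
Proof.
rewrite ge0_fin_numE; last by apply: le_ereal_inf_tmp => _ [u au <-]; exact: J_ge0.
by apply: le_lt_trans J0; apply: ereal_inf_lbound; exists (cst 0).
Qed.

Let I_le u : adm u -> (I <= J u)%E.
Proof. by move=> au; apply: ereal_inf_lbound; exists u. Qed.

Let adm_mid u v : adm u -> adm v -> adm (fun x => (u x + v x) / 2).
Proof.
move=> [mu_ u0] [mv v0]; split.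
  by apply: measurable_funM => //; exact: measurable_funD.
by move=> x Dx; rewrite divr_ge0// addr_ge0 ?u0 ?v0.
Qed.

Let mq (u v : T -> R) : measurable_fun D u -> measurable_fun D v ->
  (forall x, D x -> 0 <= u x) -> (forall x, D x -> 0 <= v x) ->
  measurable_fun D (fun x => q (u x) (v x)).
Proof.
move=> mu_ mv u0 v0.
have ms (k : T -> R) : measurable_fun D k -> measurable_fun D (fun x => Num.sqrt (k x)).
  move=> mk; apply: (@measurableT_comp _ _ _ _ _ _ (@Num.sqrt R)) => //.
  by apply: continuous_measurable_fun; exact: sqrt_continuous.
apply: measurable_funM.
  by apply: measurable_funX; apply: measurable_funB; exact: ms.
have mz : measurable_fun D (fun x => 1 + (u x + v x) / 2).
  by apply: measurable_funD => //; apply: measurable_funM => //; exact: measurable_funD.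
apply: measurable_funV_ge0 => // x Dx.
by rewrite addr_ge0// divr_ge0// addr_ge0 ?u0 ?v0.
Qed.

(** The midpoint is admissible, so its energy is at least [I]; the integral of [q] is thus at most
    [1 / kap0] times the excess [J u + J v - 2 I]. *)
Let J_gap u v : adm u -> adm v ->
  (2%:E * I + kap0%:E * \int[mu]_(x in D) (q (u x) (v x))%:E <= J u + J v)%E.
Proof.
move=> au av; have [mu_ u0] := au; have [mv v0] := av.
have am := adm_mid au av; have [mm _] := am.
set mid := (fun x => (u x + v x) / 2) in am mm.
have q0 x : D x -> (0 <= (q (u x) (v x))%:E)%E.
  by move=> Dx; rewrite lee_fin q_ge0 ?u0 ?v0.
have mq_ : measurable_fun D (fun x => (q (u x) (v x))%:E).
  by apply/measurable_EFinP; exact: mq.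
have gP : (2%:E * Phi mid + kap0%:E * \int[mu]_(x in D) (q (u x) (v x))%:E <=
           Phi u + Phi v)%E.
  have F0 k : adm k -> forall x, D x -> (0 <= (F x (k x))%:E)%E.
    by move=> [_ k0] x Dx; rewrite lee_fin F_ge0// k0.
  rewrite -!ge0_integralZl_EFin ?(ltW kap0_gt0)//; [|exact: F0|exact: mF].
  rewrite -!ge0_integralD//; [|exact: F0|exact: mF|exact: F0|exact: mF| | | |].
  - apply: ge0_le_integral => //.
    + move=> x Dx; rewrite -!EFinM -EFinD lee_fin addr_ge0// mulr_ge0 ?(ltW kap0_gt0)//.
        by have := F0 _ am _ Dx; rewrite lee_fin.
      by have := q0 _ Dx; rewrite lee_fin.
    + by apply: emeasurable_funD; apply: measurable_funeM => //; exact: mF.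
    + by apply: emeasurable_funD; exact: mF.
    + move=> x Dx; rewrite -!EFinM -!EFinD lee_fin; apply: F_gap => //.
        exact: u0.
      exact: v0.
  - by move=> x Dx; rewrite mule_ge0 ?F0.
  - by apply: measurable_funeM; exact: mF.
  - by move=> x Dx; rewrite mule_ge0 ?q0// lee_fin ltW.
  - exact: measurable_funeM.
have gB : (2%:E * B mid <= B u + B v)%E.
  have := young_modular_mid mu2 mD2 Y2 mG2 w0 mw (mdq mu_) (mdq mv).
  have -> : (fun z => (dq u z + dq v z) / 2) = dq mid; last by [].
  by apply/funext => z; rewrite /dq /mid; field.
rewrite /J addeACA; apply: le_trans (leeD gB gP).
rewrite addeA leeD2r// -ge0_muleDr ?Phi_ge0//.
by apply: lee_wpmul2l; [rewrite lee_fin|exact: (I_le am)].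
Qed.

(** * Lower semicontinuity under almost everywhere convergence *)

Let null2 (N : set T) := (N `*` setT) `|` (setT `*` N).

Let mnull2 N : measurable N -> measurable (null2 N).
Proof. by move=> mN; apply: measurableU; exact: measurableX. Qed.

Let null2_0 N : measurable N -> mu N = 0%E -> mu2 (null2 N) = 0%E.
Proof.
move=> mN N0; have z1 : mu2 (N `*` setT) = 0%E.
  by rewrite product_measure1E//= N0 mul0e.
have z2 : mu2 (setT `*` N) = 0%E by rewrite product_measure1E//= N0 mule0.
by apply: null_set_setU => //; exact: measurableX.
Qed.

(** Fatou's lemma for each of the two terms. Difference quotients converge off the pairs with a
    coordinate in [N], and these pairs are null for the product measure. *)
Let J_lsc (u_ : nat -> T -> R) u N : (forall n, adm (u_ n)) -> adm u ->
  measurable N -> mu N = 0%E ->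
  (forall x, D x -> ~ N x -> u_ n x @[n --> \oo] --> u x) ->
  (J u <= limn_einf (fun n => J (u_ n)))%E.
Proof.
move=> au_ au mN N0 cu.
have [mu_ u0] := au.
apply: le_trans (limn_einfD_ge _ _) => //; last by move=> n; exact: Phi_ge0.
apply: leeD.
  apply: (young_modular_lsc mD2 Y2 mG2 w0 mw _ _ (mnull2 mN) (null2_0 mN N0)).
  - by move=> n; apply: mdq; have [] := au_ n.
  - exact: mdq.
  - move=> z [Dz1 Dz2] Nz; apply: cvgMr_tmp; apply: cvgB; apply: cu => // Nx.
      by apply: Nz; left.
    by apply: Nz; right.
have rm k : adm k -> Phi k = (\int[mu]_(x in D `\` N) (F x (k x))%:E)%E.
  move=> [mk k0]; apply: ge0_negligible_integral => //; first exact: mF.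
  by move=> x Dx; rewrite lee_fin F_ge0// k0.
rewrite rm//.
rewrite [X in limn_einf X](_ : _ = (fun n =>
    (\int[mu]_(x in D `\` N) (F x (u_ n x))%:E)%E)); last first.
  by apply/funext => n; rewrite rm.
have mDN : measurable (D `\` N) by exact: measurableD.
have DN : D `\` N `<=` D by move=> z [].
apply: le_trans (fatou mu mDN _ _); last 2 first.
- by move=> n; apply: measurable_funS mD DN _; apply: mF; have [] := au_ n.
- by move=> n x [Dx _]; rewrite lee_fin F_ge0//; have [_] := au_ n; apply.
rewrite le_eqVlt; apply/orP; left; apply/eqP; apply: eq_integral => x.
rewrite inE => -[Dx Nx].
have : (F x (u_ n x))%:E @[n --> \oo] --> (F x (u x))%:E.
  apply: cvg_EFin; first exact: nearW.
  have cx := cu _ Dx Nx; have /andP[bx _] := b01 Dx.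
  apply: cvgD; last exact: cvg_cst; apply: cvgB.
    by apply: (cvg_comp _ _ cx); exact: (young_continuous (Y1 Dx)).
  apply: cvgMl_tmp; apply: cvg_powR_base => //; last exact: u0.
  by move=> n; have [_] := au_ n; apply.
by move/cvg_limn_einf_sup => [].
Qed.

(** * Existence of a minimizer *)

Let minimizing_seq : exists u_ : nat -> T -> R,
  forall n, adm (u_ n) /\ (J (u_ n) <= (fine I + 4^-1 ^+ n)%:E)%E.
Proof.
suff /choice[u_ uP] : forall n, exists u, adm u /\ (J u <= (fine I + 4^-1 ^+ n)%:E)%E.
  by exists u_.
move=> n.
(* The excess 4^-n, multiplied by the weight 2^n of the later estimate, still leaves the summable
   2^-n. *)
have e0 : (0 < 4^-1 ^+ n :> R) by rewrite exprn_gt0.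
have [_ [u au <-] uI] := lb_ereal_inf_adherent e0 I_fin.
by exists u; split => //; rewrite EFinD fineK// ltW.
Qed.

Let mid_bound s t x : D x -> 0 <= s -> 0 <= t ->
  1 + (s + t) / 2 <= 2 + M * (F x s + F x t).
Proof. by move=> Dx s0 t0; have := F_lin Dx s0; have := F_lin Dx t0; lra. Qed.

(** [norm_le_amgm] with [z = 1 + (u + v) / 2], integrated over [D]; the linear growth in [F_lin]
    bounds the integral of [z] by the energies. *)
Let sqrt_diff_bound u v l : adm u -> adm v -> 0 < l ->
  (\int[mu]_(x in D) `|Num.sqrt (u x) - Num.sqrt (v x)|%:E <=
   l%:E * \int[mu]_(x in D) (q (u x) (v x))%:E +
   l^-1%:E * (2%:E * mu D + M%:E * (Phi u + Phi v)))%E.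
Proof.
move=> [mu_ u0] [mv v0] l0.
have ms (k : T -> R) : measurable_fun D k -> measurable_fun D (fun x => Num.sqrt (k x)).
  move=> mk; apply: (@measurableT_comp _ _ _ _ _ _ (@Num.sqrt R)) => //.
  by apply: continuous_measurable_fun; exact: sqrt_continuous.
have Fu0 x : D x -> (0 <= (F x (u x))%:E)%E by move=> Dx; rewrite lee_fin F_ge0 ?u0.
have Fv0 x : D x -> (0 <= (F x (v x))%:E)%E by move=> Dx; rewrite lee_fin F_ge0 ?v0.
have q0 x : D x -> (0 <= (q (u x) (v x))%:E)%E.
  by move=> Dx; rewrite lee_fin q_ge0 ?u0 ?v0.
have mq_ : measurable_fun D (fun x => (q (u x) (v x))%:E).
  by apply/measurable_EFinP; exact: mq.
have mFF : measurable_fun D (fun x => (F x (u x))%:E + (F x (v x))%:E)%E.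
  by apply: emeasurable_funD; exact: mF.
have FF0 x : D x -> (0 <= (F x (u x))%:E + (F x (v x))%:E)%E.
  by move=> Dx; rewrite adde_ge0 ?Fu0 ?Fv0.
have RHS0 x : D x -> (0 <= cst 2%:E x + M%:E * ((F x (u x))%:E + (F x (v x))%:E))%E.
  move=> Dx; apply: adde_ge0; first by rewrite lee_fin.
  by apply: mule_ge0; [rewrite lee_fin ltW|exact: FF0].
rewrite -(integral_cst mu mD 2%:E) -ge0_integralD//; [|exact: mF|exact: mF].
rewrite -(ge0_integralZl_EFin mu mD FF0 mFF (ltW M_gt0)).
rewrite -ge0_integralD//; last 3 first.
- by move=> x _; rewrite lee_fin.
- by move=> x Dx; rewrite mule_ge0 ?FF0// lee_fin ltW.
- exact: measurable_funeM.
rewrite -ge0_integralZl_EFin ?(ltW l0)//.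
rewrite -ge0_integralZl_EFin ?invr_ge0 ?(ltW l0)//; last first.
  by apply: emeasurable_funD => //; exact: measurable_funeM.
rewrite -ge0_integralD//; last 4 first.
- by move=> x Dx; rewrite mule_ge0 ?q0// lee_fin ltW.
- exact: measurable_funeM.
- by move=> x Dx; apply: mule_ge0; [rewrite lee_fin invr_ge0 ltW|exact: RHS0].
- by apply: measurable_funeM; apply: emeasurable_funD => //; exact: measurable_funeM.
apply: ge0_le_integral => //.
- apply/measurable_EFinP; apply: measurableT_comp => //.
  by apply: measurable_funB; exact: ms.
- apply: emeasurable_funD; first exact: measurable_funeM.
  by apply: measurable_funeM; apply: emeasurable_funD => //; exact: measurable_funeM.
- move=> x Dx; rewrite -!(EFinD, EFinM) lee_fin.
  have z0 : 0 < 1 + (u x + v x) / 2.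
    by have := u0 _ Dx; have := v0 _ Dx; lra.
  apply: (le_trans (norm_le_amgm _ z0 l0)); rewrite lerD2l mulrC.
  by rewrite ler_wpM2l ?invr_ge0 ?(ltW l0)// mid_bound ?u0 ?v0.
Qed.

Let minimizer_exists : exists u, adm u /\ forall v, adm v -> (J u <= J v)%E.
Proof.
have [u_ u_P] := minimizing_seq.
have au n := (u_P n).1.
have Ju n : (J (u_ n) <= (fine I + 4^-1 ^+ n)%:E)%E := (u_P n).2.
have q4 : 4^-1 <= 1 :> R by rewrite invf_le1// ler1n.
have pow_le1 n : (4^-1 ^+ n <= 1 :> R) by apply: exprn_ile1.
(* [C] bounds the weight term along the sequence, [2 / kap0] comes from the gap inequality, and the
   factor 2 in [r] compensates the exponent [n + 1] of the summability lemma. *)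
pose C := 2 * fine (mu D) + M * (2 * (fine I + 1)).
pose r := 2 * (2 / kap0 + C).
have incr n : (\int[mu]_(x in D) `|Num.sqrt (u_ n.+1 x) - Num.sqrt (u_ n x)|%:E <=
              (r / (2 ^ (n + 1))%:R)%:E)%E.
  have p2 : (0 < 2 ^+ n :> R) by rewrite exprn_gt0.
  apply: (le_trans (sqrt_diff_bound (au n.+1) (au n) p2)).
  have := J_gap (au n.+1) (au n).
  have PhiJ k : (Phi (u_ k) <= (fine I + 1)%:E)%E.
    apply: (@le_trans _ _ (J (u_ k))); first by rewrite /J leeDr.
    by apply: (le_trans (Ju k)); rewrite lee_fin lerD2l.
  have := PhiJ n; have := PhiJ n.+1.
  have := Phi_ge0 (au n); have := Phi_ge0 (au n.+1).
  have := leeD (Ju n.+1) (Ju n).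
  have Q0 : (0 <= \int[mu]_(x in D) (q (u_ n.+1 x) (u_ n x))%:E)%E.
    by apply: integral_ge0 => x Dx; rewrite lee_fin q_ge0// ?(au _).2//; apply: (au _).2.
  move: Q0; set Q := (\int[mu]_(x in D) (q _ _)%:E)%E => Q0 JJ.
  have muDE : mu D = (fine (mu D))%:E by rewrite fineK// ge0_fin_numE.
  case: (Phi (u_ n)) => [p|//|//]; case: (Phi (u_ n.+1)) => [p'|//|//].
  rewrite !lee_fin => p'0 p0 p'I pI gap.
  have {gap JJ} := le_trans gap JJ.
  have -> : (2%:E * I = (2 * fine I)%:E)%E by rewrite EFinM fineK.
  case: Q Q0 => [Q|//|//]; rewrite ?lee_fin; last first.
    by rewrite gt0_muley ?lte_fin.
  move=> Q0 gap.
  rewrite muDE -!(EFinM, EFinD) lee_fin.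
  have e1 : 4^-1 ^+ n.+1 <= 4^-1 ^+ n :> R.
    by rewrite exprS ger_pMl ?exprn_gt0.
  have kQ : Q <= 2 / kap0 * 4^-1 ^+ n.
    by rewrite -(ler_pM2l kap0_gt0) mulrA mulrCA mulfV ?gt_eqF// mulr1; lra.
  have -> : r / (2 ^ (n + 1))%:R = (2 ^+ n)^-1 * (2 / kap0 + C).
    rewrite /r natrX addn1 exprS; field; rewrite !gt_eqF//.
  have -> : (2 ^+ n)^-1 * (2 / kap0 + C) = 2 ^+ n * (2 / kap0 * 4^-1 ^+ n) + (2 ^+ n)^-1 * C.
    have -> : 4^-1 = 2^-1 * 2^-1 :> R by field.
    by rewrite exprMn exprVn; field; rewrite !gt_eqF.
  apply: lerD; first by rewrite ler_pM2l.
  rewrite ler_pM2l ?invr_gt0// /C; apply: lerD => //.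
  by rewrite ler_pM2l//; lra.
have ms n : measurable_fun D (fun x => Num.sqrt (u_ n x)).
  apply: (@measurableT_comp _ _ _ _ _ _ (@Num.sqrt R)); last exact: (au n).1.
  by apply: continuous_measurable_fun; exact: sqrt_continuous.
have [N [mN N0 NP]] := ae_cvg_summable_increments mD ms incr.
(* The sequence converges to the square of the limit of its square roots. The value 0 on [N] makes
   [u] the limit on [D] of the [u_ n] cut off on [N], hence measurable. *)
pose u x : R := if x \in N then 0 else (limn (fun n => Num.sqrt (u_ n x))) ^+ 2.
have cu x : D x -> ~ N x -> u_ n x @[n --> \oo] --> u x.
  move=> Dx Nx; have cx := NP x Dx Nx.
  rewrite /u memNset// expr2.
  have -> : u_ ^~ x = (fun n => Num.sqrt (u_ n x) * Num.sqrt (u_ n x)).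
    by apply/funext => n; rewrite -expr2 sqr_sqrtr//; exact: (au n).2.
  exact: cvgM.
have au0 : adm u.
  split; last by move=> x Dx; rewrite /u; case: ifP => // _; rewrite sqr_ge0.
  apply: (@measurable_fun_cvg _ _ _ _ (fun n x => u_ n x * \1_(~` N) x)).
    move=> n; apply: measurable_funM; first exact: (au n).1.
    by apply: measurable_funTS; apply: measurable_indic; exact: measurableC.
  move=> x Dx; have [Nx|Nx] := pselect (N x).
    rewrite /u indicE in_setC mem_set//=.
    by under eq_fun do rewrite mulr0; exact: cvg_cst.
  rewrite indicE in_setC memNset//=; under eq_fun do rewrite mulr1.
  exact: cu.
exists u; split; first exact: au0.
move=> v av; apply: (@le_trans _ _ I); last exact: (I_le av).
apply: (le_trans (J_lsc au au0 mN N0 cu)).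
rewrite -(fineK I_fin); apply: (limn_einf_le_cvg Ju).
by apply: cvg_expr; rewrite ger0_norm// invf_lt1// ltr1n.
Qed.

(** * Integrability of the terms of the energy *)

Implicit Types p v : T -> R.

Let AE p : A p = (\int[mu]_(x in D) (G1 x (p x))%:E)%E.
Proof. by apply: eq_integral => x _; rewrite mulr1. Qed.

Let mG1p p : measurable_fun D p -> measurable_fun D (fun x => G1 x (p x)).
Proof. exact: (measurable_young_comp mD Y1 mG1). Qed.

Let iG1 p : measurable_fun D p -> (A p < +oo)%E ->
  mu.-integrable D (EFin \o (fun x => G1 x (p x))).
Proof.
move=> mp Ap; apply/integrableP; split; first by apply/measurable_EFinP; exact: mG1p.
apply: le_lt_trans Ap; rewrite AE le_eqVlt; apply/orP; left; apply/eqP.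
apply: eq_integral => x; rewrite inE => Dx.
by rewrite gee0_abs// lee_fin (young_ge0 (Y1 Dx)).
Qed.

Let icst (c : R) : mu.-integrable D (EFin \o cst c).
Proof.
apply/integrableP; split; first by apply/measurable_EFinP.
by rewrite (eq_integral (cst `|c|%:E))// integral_cst// lte_mul_pinfty// lee_fin.
Qed.

Let iH p : adm p -> (A p < +oo)%E ->
  mu.-integrable D (EFin \o (fun x => H x (p x))).
Proof.
move=> [mp p0] Ap.
have iD : mu.-integrable D (EFin \o (fun x => G1 x (p x) + C0)).
  by apply: (integrableD mD (iG1 mp Ap) (icst C0)).
apply: le_integrable iD => //; first by apply/measurable_EFinP; exact: mH.
move=> x Dx /=; rewrite lee_fin.
have g0 := young_ge0 (Y1 Dx) (p x).
rewrite !ger0_norm ?addr_ge0 ?H_ge0//.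
apply: (le_trans (H_le Dx (p0 _ Dx))); rewrite lerD2r; lra.
Qed.

Let IH p := \int[mu]_(x in D) H x (p x).

Let PhiE p : adm p -> (A p < +oo)%E ->
  Phi p = (fine (A p) - IH p + C0 * fine (mu D))%:E.
Proof.
move=> ap Ap; have [mp p0] := ap.
have iG := iG1 mp Ap; have ih := iH ap Ap.
have -> : fine (A p) = \int[mu]_(x in D) G1 x (p x) by rewrite AE.
rewrite /IH -RintegralB// -Rintegral_cst// -RintegralD//; last 2 first.
- exact: (integrableB mD iG ih).
- exact: icst.
rewrite /Rintegral fineK//; apply: integrable_fin_num => //.
exact: (integrableD mD (integrableB mD iG ih) (icst C0)).
Qed.

Let energy (v : T -> R) :=
  [/\ measurable_fun D v, (A v < +oo)%E & (B v < +oo)%E].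

(** * Variations around a minimizer *)

Section minimizer.
Context (u : T -> R) (au : adm u) (umin : forall v, adm v -> (J u <= J v)%E).

Let mu_ : measurable_fun D u. Proof. exact: au.1. Qed.
Let u0 x : D x -> 0 <= u x. Proof. exact: au.2. Qed.

Let Ju : (J u < +oo)%E.
Proof. exact: le_lt_trans (umin adm0) J0. Qed.

Let Bu : (B u < +oo)%E.
Proof. by apply: le_lt_trans Ju; rewrite /J leeDl// Phi_ge0. Qed.

Let Phiu : (Phi u < +oo)%E.
Proof. by apply: le_lt_trans Ju; rewrite /J leeDr. Qed.

Let Au : (A u < +oo)%E.
Proof.
apply: (@le_lt_trans _ _ (2%:E * Phi u)%E); last by rewrite lte_mul_pinfty.
rewrite AE /Phi -ge0_integralZl_EFin//; last 2 first.
- by move=> x Dx; rewrite lee_fin F_ge0 ?u0.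
- exact: mF.
apply: ge0_le_integral => //.
- by move=> x Dx; rewrite lee_fin (young_ge0 (Y1 Dx)).
- by apply/measurable_EFinP; exact: mG1p.
- by apply: measurable_funeM; exact: mF.
- by move=> x Dx; rewrite -EFinM lee_fin; have := F_ge Dx (u0 Dx); lra.
Qed.

Let dqD (v : T -> R) (n : nat) :
  dq (fun x => u x + v x / n.+1%:R) = (fun z => dq u z + dq v z / n.+1%:R).
Proof. by apply/funext => z; rewrite /dq; ring. Qed.

Let pert (v : T -> R) (n : nat) x := Num.max 0 (u x + v x / n.+1%:R).

Let mpert0 v (n : nat) : measurable_fun D v -> measurable_fun D (fun x => u x + v x / n.+1%:R).
Proof. by move=> mv; apply: measurable_funD => //; exact: measurable_funM. Qed.

Let apert v n : measurable_fun D v -> adm (pert v n).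
Proof.
move=> mv; split; last by move=> x _; rewrite le_max lexx.
by apply: measurable_maxr => //; exact: mpert0.
Qed.

Let max0_lip (s t : R) : `|Num.max 0 s - Num.max 0 t| <= `|s - t|.
Proof.
rewrite ler_norml; case: (leP 0 s) => s0; case: (leP 0 t) => t0;
  have [st|st] := ler0P (s - t); rewrite ?subr0 ?sub0r; lra.
Qed.

Let Bpert_lty v n : energy v -> (B (fun x => (u x + v x / n.+1%:R)%R) < +oo)%E.
Proof.
move=> [mv _ Bv]; rewrite /B dqD.
apply: (young_modularD_lty mD2 K0 Y2 mG2 w0 mw (mdq mu_) _ Bu).
  by apply: measurable_funM => //; exact: mdq.
under eq_fun do rewrite mulrC.
exact: (young_modular_scale_lty mD2 K0 Y2 mG2 w0 mw _ (mdq mv) Bv).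
Qed.

Let Apert_lty v n : energy v -> (A (fun x => (u x + v x / n.+1%:R)%R) < +oo)%E.
Proof.
move=> [mv Av _].
apply: (young_modularD_lty mD K0 Y1 mG1 p1 m1 mu_ _ Au).
  by apply: measurable_funM.
under eq_fun do rewrite mulrC.
exact: (young_modular_scale_lty mD K0 Y1 mG1 p1 m1 _ mv Av).
Qed.

Let perturbation_ineq v n : energy v ->
  IH (pert v n) - IH u <=
  (fine (A (fun x => u x + v x / n.+1%:R)) - fine (A u)) +
  (fine (B (fun x => u x + v x / n.+1%:R)) - fine (B u)).
Proof.
move=> ev; have [mv Av Bv] := ev.
have ap := apert n mv; have [mp p0] := ap.
have Bpl := Bpert_lty n ev; have Apl := Apert_lty n ev.
have mp0 := mpert0 n mv.
have Bp : (B (pert v n) <= B (fun x => (u x + v x / n.+1%:R)%R))%E.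
  apply: (le_young_modular mu2 mD2 Y2 mG2 w0 mw (mdq mp) (mdq mp0)) => z _.
  by rewrite !normrM ler_wpM2r// max0_lip.
have Ap : (A (pert v n) <= A (fun x => (u x + v x / n.+1%:R)%R))%E.
  apply: (le_young_modular mu mD Y1 mG1 p1 m1 mp mp0) => x _.
  by have := max0_lip (u x + v x / n.+1%:R) 0; rewrite maxxx !subr0.
have := umin ap; rewrite /J (PhiE au Au) (PhiE ap (le_lt_trans Ap Apl)).
move: Bp Ap Bpl Apl Bu Au (B_ge0 u) (B_ge0 (pert v n)) (young_modular_ge0 mu Y1 p1 u)
  (young_modular_ge0 mu Y1 p1 (pert v n)); rewrite -/(A u) -/(A (pert v n)).
set pv := (fun x => u x + v x / n.+1%:R).
case: (B pv) => [x|//|]; case: (A pv) => [y|//|];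
  case: (B u) => [x'|//|//]; case: (A u) => [y'|//|//];
  case: (B (pert v n)) => [x''|//|//]; case: (A (pert v n)) => [y''|//|//] //=.
rewrite -!EFinD !lee_fin; move: (IH u) (IH (pert v n)) (C0 * fine _) => i i' c.
lra.
Qed.

(** Derivative of the convex part of the energy at [u] in the direction [v]; the factor [cst 1] is
    the weight of the modular on [D]. *)
Let L v := \int[mu]_(x in D) (g1 x (u x) * v x * cst 1 x) +
  \int[mu2]_(z in D2) (g2 z (dq u z) * dq v z * w z).

Let rate v (n : nat) := n.+1%:R *
  ((fine (A (fun x => u x + v x / n.+1%:R)) - fine (A u)) +
   (fine (B (fun x => u x + v x / n.+1%:R)) - fine (B u))).

Let rate_cvg v : energy v -> rate v n @[n --> \oo] --> L v.
Proof.
move=> [mv Av Bv].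
have cA : n.+1%:R * (fine (A (fun x => u x + v x / n.+1%:R)) - fine (A u))
    @[n --> \oo] --> \int[mu]_(x in D) (g1 x (u x) * v x * cst 1 x).
  exact: (young_modular_gateaux mD K0 Y1 mG1 p1 m1 mu_ mv Au Av).
have cB : n.+1%:R * (fine (B (fun x => u x + v x / n.+1%:R)) - fine (B u))
    @[n --> \oo] --> \int[mu2]_(z in D2) (g2 z (dq u z) * dq v z * w z).
  under eq_fun do rewrite /B dqD.
  exact: (young_modular_gateaux mD2 K0 Y2 mG2 w0 mw (mdq mu_) (mdq mv) Bu Bv).
have -> : rate v = (fun n => n.+1%:R * (fine (A (fun x => u x + v x / n.+1%:R)) - fine (A u)))
    \+ (fun n => n.+1%:R * (fine (B (fun x => u x + v x / n.+1%:R)) - fine (B u))).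
  by apply/funext => n; rewrite /rate mulrDr.
exact: cvgD.
Qed.

Let incr_le v n : energy v -> n.+1%:R * (IH (pert v n) - IH u) <= rate v n.
Proof. by move=> ev; rewrite ler_pM2l ?ltr0n// perturbation_ineq. Qed.

Let H_homo x s t : D x -> 0 <= s -> s <= t -> H x s <= H x t.
Proof.
move=> Dx s0 st; have /andP[bx _] := b01 Dx.
rewrite ler_pM2l ?hb_gt0//; apply: ge0_ler_powR; rewrite ?nnegrE ?(ltW bx)//.
exact: le_trans st.
Qed.

Let energy1 : energy (cst 1).
Proof.
split; first exact: measurable_cst.
  rewrite AE; apply: (@le_lt_trans _ _ (\int[mu]_(x in D) cst C2%:E x)%E).
    apply: ge0_le_integral => //.
    - by move=> x Dx; rewrite lee_fin (young_ge0 (Y1 Dx)).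
    - by apply/measurable_EFinP; apply: mG1p.
  rewrite integral_cst//.
  have : (C2%:E * mu D <= `|C2|%:E * mu D)%E by rewrite lee_wpmul2r// lee_fin ler_norm.
  by move/le_lt_trans; apply; rewrite lte_mul_pinfty// lee_fin.
rewrite /B /young_modular integral0_eq ?ltry// => z Dz.
by rewrite /dq subrr mul0r (young0 (Y2 Dz)) mul0r.
Qed.

Let Apert v n : energy v -> (A (pert v n) < +oo)%E.
Proof.
move=> ev; have [mv _ _] := ev; have [mp _] := apert n mv.
apply: le_lt_trans (Apert_lty n ev).
apply: (le_young_modular mu mD Y1 mG1 p1 m1 mp (mpert0 n mv)) => x _.
by have := max0_lip (u x + v x / n.+1%:R) 0; rewrite maxxx !subr0.
Qed.

(* Testing with the constant 1, whose difference quotient vanishes: on the zero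
   set of [u] the singular term gains [n^(1 - b)] while the rest stays bounded. *)
Lemma minimizer_zero_set : mu (D `&` [set x | u x = 0]) = 0%E.
Proof.
set Z := D `&` _.
have mZ : measurable Z.
  have -> : Z = D `&` u @^-1` [set 0] by [].
  by apply: mu_ => //; exact: measurable_set1.
have muZ : mu Z \is a fin_num.
  rewrite ge0_fin_numE//; apply: le_lt_trans muD.
  by apply: le_measure; rewrite ?inE//; exact: subIsetl.
apply/eqP; rewrite eq_le measure_ge0 andbT leNgt; apply/negP => Z0.
have z0 : 0 < fine (mu Z) by rewrite fine_gt0// Z0 -ge0_fin_numE.
have [c XP] : exists c, forall n, rate (cst 1) n <= c.
  have /cvg_seq_bounded[c [_ XP]] : cvgn (rate (cst 1)).
    by apply/cvg_ex; eexists; exact: rate_cvg.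
  exists (c + 1) => n; apply: (le_trans (ler_norm _)); apply: XP => //.
  by rewrite ltrDl.
(* On the zero set the competitor equals [1 / n.+1], and there [h / b >= h0] and [b <= b1];
   elsewhere the increment of [H] is nonnegative. *)
have key n : h0 * (n.+1%:R * n.+1%:R^-1 `^ b1) * fine (mu Z) <= c.
  apply: le_trans (XP n); apply: le_trans (incr_le n energy1).
  have n0 : (0 < n.+1%:R :> R) by rewrite ltr0n.
  have [m1c _ _] := energy1; have ap := apert n m1c.
  have iZ : mu.-integrable D (EFin \o (\1_Z : T -> R)).
    apply: le_integrable (icst 1) => //.
      by apply/measurable_EFinP; apply: measurable_funTS; exact: measurable_indic.
    by move=> x _ /=; rewrite lee_fin indicE normr1; case: (x \in Z); rewrite ?normr1 ?normr0.
  have iZc : mu.-integrable D (EFin \o (fun x => h0 * n.+1%:R^-1 `^ b1 * \1_Z x)).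
    exact: (integrableZl mD _ iZ).
  have i1 := iH ap (Apert n energy1); have i2 := iH au Au.
  rewrite mulrCA -!mulrA ler_pM2l// mulrA.
  rewrite -[X in _ <= _ - X]/(\int[mu]_(x in D) H x (u x)) /IH -RintegralB//.
  have -> : h0 * n.+1%:R^-1 `^ b1 * fine (mu Z) =
      \int[mu]_(x in D) (h0 * n.+1%:R^-1 `^ b1 * \1_Z x).
    rewrite RintegralZl//; congr (_ * _).
    rewrite /Rintegral integral_indic//; congr (fine (mu _)).
    by rewrite setIAC setIid.
  apply: le_Rintegral => //.
  - exact: (integrableB mD i1 i2).
  move=> x Dx; have [Zx|Zx] := pselect (Z x); last first.
    rewrite indicE memNset//= mulr0 subr_ge0; apply: H_homo => //; first exact: u0.
    by rewrite le_max lerDl divr_ge0 ?orbT.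
  rewrite indicE mem_set//= mulr1; have [_ /= ux] := Zx.
  have /andP[bx0 bx1] := b01 Dx; have /andP[_ bxb] := b_bnd Dx.
  have hx := lt_le_trans h0_gt0 (h_ge Dx).
  have i0 : 0 < n.+1%:R^-1 :> R by rewrite invr_gt0.
  have -> : H x (u x) = 0 by rewrite /H ux powR0 ?gt_eqF// mulr0.
  rewrite subr0 /H /pert ux add0r div1r (max_idPr (ltW i0)).
  apply: ler_pM; [exact: ltW|exact: powR_ge0| |].
    apply: (le_trans (h_ge Dx)); rewrite ler_peMr ?(ltW hx)//.
    by rewrite invf_ge1// ltW.
  apply: ger_powR => //; rewrite i0/= invf_le1// ler1n//.
have c0 : 0 < h0 * fine (mu Z) by rewrite mulr_gt0.
(* Large enough that [h0 * fine (mu Z) * Y > c]; the power [1 / (1 - b1)] then gives an [n] with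
   [n.+1^(1 - b1) >= Y]. *)
pose Y := `|c| / (h0 * fine (mu Z)) + 1.
have e0 : 0 < 1 - b1 by rewrite subr_gt0.
have Y0 : 0 < Y by rewrite /Y ltr_wpDl// divr_ge0// ltW.
pose n := Num.bound (Y `^ (1 - b1)^-1).
have nY : Y `^ (1 - b1)^-1 <= n.+1%:R.
  apply: (le_trans (ltW (archi_boundP (powR_ge0 _ _)))).
  by rewrite ler_nat.
have n0 : (0 < n.+1%:R :> R) by rewrite ltr0n.
have YE : Y <= n.+1%:R * n.+1%:R^-1 `^ b1.
  have -> : n.+1%:R * n.+1%:R^-1 `^ b1 = n.+1%:R `^ (1 - b1) :> R.
    rewrite -powR_inv1 ?(ltW n0)// -powRrM mulN1r.
    rewrite -{1}[n.+1%:R](@powRr1 R) ?(ltW n0)// -powRD//.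
    by rewrite (gt_eqF n0) implybT.
  have -> : Y = (Y `^ (1 - b1)^-1) `^ (1 - b1).
    by rewrite -powRrM mulVf ?gt_eqF// powRr1// ltW.
  by apply: ge0_ler_powR; rewrite ?nnegrE ?powR_ge0 ?(ltW n0) ?(ltW e0).
have := key n; apply/negP; rewrite -ltNge mulrAC.
apply: (@lt_le_trans _ _ (h0 * fine (mu Z) * Y)); last by rewrite ler_pM2l.
rewrite /Y mulrDr mulr1 mulrC divfK ?gt_eqF//.
by apply: (le_lt_trans (ler_norm c)); rewrite ltrDl.
Qed.

(** * The weak equation for a positive minimizer *)

Section positive.
Context (upos : forall x, D x -> 0 < u x).

Let sing v x := h x * u x `^ (b x - 1) * v x.
Let kq v (n : nat) x := n.+1%:R * (H x (pert v n x) - H x (u x)).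

Let msing v : measurable_fun D v -> measurable_fun D (sing v).
Proof.
move=> mv; apply: measurable_funM => //; apply: measurable_funM => //.
by apply: measurable_fun_powR2 => //; exact: measurable_funB.
Qed.

Let mkq v n : measurable_fun D v -> measurable_fun D (kq v n).
Proof.
move=> mv; apply: measurable_funM => //.
by apply: measurable_funB; apply: mH => //; have [] := apert n mv.
Qed.

Let kq_cvg v x : D x -> kq v n x @[n --> \oo] --> sing v x.
Proof.
move=> Dx; have /andP[bx0 _] := b01 Dx.
have c1 := @diff_quotient_powR_cvg R (u x) (v x) (b x) (upos Dx).
have c2 : h x / b x * (n.+1%:R * ((u x + v x / n.+1%:R) `^ b x - u x `^ b x))
    @[n --> \oo] --> sing v x.
  have -> : sing v x = h x / b x * (b x * u x `^ (b x - 1) * v x).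
    by rewrite /sing; field; rewrite gt_eqF.
  exact: cvgMl_tmp.
(* Since [u x > 0], the truncation is inactive for large [n]. *)
have pos : \forall n \near \oo, 0 < u x + v x / n.+1%:R.
  have : u x + v x / n.+1%:R @[n --> \oo] --> u x + v x * 0.
    apply: cvgD; first exact: cvg_cst.
    by apply: cvgMl_tmp; exact: (@cvg_harmonic R).
  by move/cvgr_gt; apply; rewrite mulr0 addr0 upos.
apply: cvg_trans c2; apply: near_eq_cvg; near=> n.
have pn : 0 < u x + v x / n.+1%:R by near: n.
rewrite /kq /H /pert (max_idPr (ltW pn)); ring.
Unshelve. all: by end_near. Qed.

(** The factor [b0^-1] bounds the [1 / b] of [H], which stays uncancelled because the Lipschitz
    bound for the truncated power has slope [u^(b-1)] without the factor [b]. *)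
Let dom v x := b0^-1 * (h x * u x `^ (b x - 1) * `|v x|).

Let kq_bound v n x : D x -> `|kq v n x| <= dom v x.
Proof.
move=> Dx; have /andP[bl _] := b_bnd Dx; have bx := lt_le_trans b0_gt0 bl.
have n0 : (0 < n.+1%:R :> R) by rewrite ltr0n.
have h00 := ltW (lt_le_trans h0_gt0 (h_ge Dx)).
have := powR_trunc_lip (v x / n.+1%:R) (upos Dx) (b01 Dx).
rewrite -(ler_pM2l n0) -(ler_pM2l (hb_gt0 Dx)).
have -> : h x / b x * (n.+1%:R * `|Num.max 0 (u x + v x / n.+1%:R) `^ b x - u x `^ b x|) =
    `|kq v n x|.
  rewrite /kq /H /pert -mulrBr !normrM (ger0_norm h00) (gtr0_norm n0).
  by rewrite ger0_norm ?invr_ge0 ?(ltW bx)//; ring.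
move/le_trans; apply.
rewrite normrM normfV (gtr0_norm n0).
have -> : h x / b x * (n.+1%:R * (u x `^ (b x - 1) * (`|v x| / n.+1%:R))) =
   (b x)^-1 * (h x * u x `^ (b x - 1) * `|v x|) by field; rewrite !gt_eqF.
apply: ler_wpM2r; first by rewrite !mulr_ge0// powR_ge0.
by rewrite lef_pV2.
Qed.

Let kq_integral v n : energy v ->
  (\int[mu]_(x in D) (kq v n x)%:E)%E = (n.+1%:R * (IH (pert v n) - IH u))%:E.
Proof.
move=> ev; have [mv _ _] := ev.
have i1 := iH (apert n mv) (Apert n ev); have i2 := iH au Au.
have i3 := integrableB mD i1 i2.
rewrite /IH -RintegralB// -RintegralZl//.
rewrite /Rintegral fineK//; apply: integrable_fin_num => //.
exact: (integrableZl mD _ i3).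
Qed.

(** Fatou's lemma: for [v >= 0] the quotients are nonnegative, and their integrals are at most
    [rate v n], which converges to the finite [L v]. *)
Let sing_integrable_ge0 v : energy v -> (forall x, 0 <= v x) ->
  mu.-integrable D (EFin \o sing v).
Proof.
move=> ev v0; have [mv _ _] := ev.
apply/integrableP; split; first by apply/measurable_EFinP; exact: msing.
have kq0 n x : D x -> (0 <= (kq v n x)%:E)%E.
  move=> Dx; rewrite lee_fin /kq pmulr_rge0 ?ltr0n// subr_ge0; apply: H_homo => //.
    exact: u0.
  by rewrite le_max lerDl divr_ge0 ?orbT.
have -> : (\int[mu]_(x in D) `|(EFin \o sing v) x|)%E =
    (\int[mu]_(x in D) limn_einf (fun n => (kq v n x)%:E))%E.
  apply: eq_integral => x; rewrite inE => Dx.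
  have h00 := ltW (lt_le_trans h0_gt0 (h_ge Dx)).
  rewrite gee0_abs/=; last by rewrite lee_fin !mulr_ge0// powR_ge0.
  have /cvg_limn_einf_sup[-> _//] : (kq v n x)%:E @[n --> \oo] --> (sing v x)%:E.
  by apply: cvg_EFin; [exact: nearW|exact: kq_cvg].
apply: le_lt_trans (fatou mu mD _ kq0) _.
  by move=> n; apply/measurable_EFinP; exact: mkq.
apply: (@le_lt_trans _ _ (L v)%:E); last exact: ltry.
have -> : (fun n => \int[mu]_(x in D) (kq v n x)%:E)%E =
    (fun n => (n.+1%:R * (IH (pert v n) - IH u))%:E).
  by apply/funext => n; rewrite kq_integral.
apply: (@limn_einf_le_cvg _ _ _ (fun n => rate v n - L v)).
  by move=> n; rewrite lee_fin subrKC incr_le.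
by rewrite -(subrr (L v)); apply: cvgB; [exact: rate_cvg|exact: cvg_cst].
Qed.

Let energy_norm v : energy v -> energy (fun x => `|v x|).
Proof.
move=> [mv Av Bv].
have mn : measurable_fun D (fun x => `|v x|) by exact: measurableT_comp.
split => //.
  apply: le_lt_trans Av; apply: (le_young_modular mu mD Y1 mG1 p1 m1 mn mv) => x _.
  by rewrite normr_id.
apply: le_lt_trans Bv.
apply: (le_young_modular mu2 mD2 Y2 mG2 w0 mw (mdq mn) (mdq mv)) => z _.
by rewrite !normrM ler_wpM2r// ler_dist_dist.
Qed.

Let sing_integrable v : energy v -> mu.-integrable D (EFin \o sing v).
Proof.
move=> ev; have [mv _ _] := ev.
have iv : mu.-integrable D (EFin \o sing (fun x => `|v x|)).
  by apply: sing_integrable_ge0 => //; exact: energy_norm.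
apply: le_integrable iv => //; first by apply/measurable_EFinP; exact: msing.
by move=> x Dx /=; rewrite lee_fin /sing !normrM normr_id.
Qed.

(** With [dom v] now integrable, dominated convergence passes to the limit in [incr_le], whatever
    the sign of [v]. *)
Let sing_le v : energy v -> \int[mu]_(x in D) sing v x <= L v.
Proof.
move=> ev; have [mv _ _] := ev.
have iv : mu.-integrable D (EFin \o sing (fun x => `|v x|)).
  by apply: sing_integrable; exact: energy_norm.
have mk n : measurable_fun D (EFin \o kq v n) by apply/measurable_EFinP; exact: mkq.
have ms : measurable_fun D (EFin \o sing v) by apply/measurable_EFinP; exact: msing.
have ck : {ae mu, forall x, D x -> (EFin \o kq v n) x @[n --> \oo] --> (EFin \o sing v) x}.
  by apply: aeW => x Dx; apply: cvg_EFin; [exact: nearW|exact: kq_cvg].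
have bk : {ae mu, forall x n, D x -> (`|(EFin \o kq v n) x| <= (dom v x)%:E)%E}.
  by apply: aeW => x n Dx; rewrite lee_fin kq_bound.
have [_ _] := dominated_convergence mD mk ms ck (integrableZl mD _ iv) bk.
rewrite -(fineK (integrable_fin_num mD (sing_integrable ev))) => /fine_cvgP[_ cS].
apply: (ler_cvg_to cS (rate_cvg ev)); near=> n.
by rewrite /= kq_integral//= incr_le.
Unshelve. all: by end_near. Qed.

Let energyN v : energy v -> energy (fun x => - v x).
Proof.
move=> [mv Av Bv].
have mn : measurable_fun D (fun x => - v x) by exact: measurable_funN.
split => //.
  apply: le_lt_trans Av; apply: (le_young_modular mu mD Y1 mG1 p1 m1 mn mv) => x _.
  by rewrite normrN.
apply: le_lt_trans Bv.
apply: (le_young_modular mu2 mD2 Y2 mG2 w0 mw (mdq mn) (mdq mv)) => z _.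
by rewrite !normrM -opprD normrN.
Qed.

Lemma positive_minimizer_weak_solution v : energy v ->
  [/\ mu2.-integrable D2 (EFin \o (fun z => g2 z (dq u z) * dq v z * w z)),
      mu.-integrable D (EFin \o (fun x => g1 x (u x) * v x)),
      mu.-integrable D (EFin \o (fun x => h x * u x `^ (b x - 1) * v x)) &
      \int[mu2]_(z in D2) (g2 z (dq u z) * dq v z * w z) +
      \int[mu]_(x in D) (g1 x (u x) * v x) =
      \int[mu]_(x in D) (h x * u x `^ (b x - 1) * v x)].
Proof.
move=> ev; have [mv Av Bv] := ev.
have i2 := young_grad_integrable mD2 K0 Y2 mG2 w0 mw (mdq mu_) (mdq mv) Bu Bv.
have := young_grad_integrable mD K0 Y1 mG1 p1 m1 mu_ mv Au Av.
have e1 : (fun x => g1 x (u x) * v x * cst 1 x) = (fun x => g1 x (u x) * v x).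
  by apply/funext => x; rewrite mulr1.
have -> : (fun x => (g1 x (u x) * v x * cst 1 x)%:E) =
    EFin \o (fun x => g1 x (u x) * v x).
  by apply/funext => x /=; rewrite mulr1.
move=> i1; have i3 := sing_integrable ev.
split => //.
have LE : L v = \int[mu2]_(z in D2) (g2 z (dq u z) * dq v z * w z) +
    \int[mu]_(x in D) (g1 x (u x) * v x) by rewrite /L e1 addrC.
rewrite -LE; apply/eqP; rewrite eq_le (sing_le ev) andbT -lerN2.
have := sing_le (energyN ev).
have -> : \int[mu]_(x in D) sing (fun x => - v x) x = - \int[mu]_(x in D) sing v x.
  rewrite -mulN1r -RintegralZl//; apply: eq_Rintegral => x _.
  by rewrite /sing mulrN mulN1r.
suff -> : L (fun x => - v x) = - L v by [].
rewrite LE /L opprD addrC; congr (_ + _).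
  rewrite -mulN1r -RintegralZl//; apply: eq_Rintegral => z _.
  by rewrite /dq; ring.
rewrite -mulN1r -RintegralZl//; apply: eq_Rintegral => x _.
by rewrite /=; ring.
Qed.

End positive.

Lemma minimizer_energy : energy u.
Proof. by split. Qed.

End minimizer.

Lemma singular_weak_solution : exists u : T -> R, (forall x, ~ D x -> u x = 0) /\
  [/\ measurable_fun D u,
      forall x, D x -> 0 < u x,
      (young_modular mu D G1 (cst 1%R) u < +oo)%E,
      (young_modular mu2 (D `*` D) G2 w
        (fun z => ((u z.1 - u z.2) * kap z)%R) < +oo)%E &
      forall v : T -> R, measurable_fun D v ->
        (young_modular mu D G1 (cst 1%R) v < +oo)%E ->
        (young_modular mu2 (D `*` D) G2 w
          (fun z => ((v z.1 - v z.2) * kap z)%R) < +oo)%E ->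
        [/\ mu2.-integrable (D `*` D) (EFin \o (fun z =>
              g2 z ((u z.1 - u z.2) * kap z) * ((v z.1 - v z.2) * kap z) * w z)),
            mu.-integrable D (EFin \o (fun x => g1 x (u x) * v x)),
            mu.-integrable D (EFin \o (fun x => h x * u x `^ (b x - 1) * v x)) &
            \int[mu2]_(z in D `*` D)
              (g2 z ((u z.1 - u z.2) * kap z) * ((v z.1 - v z.2) * kap z) * w z) +
            \int[mu]_(x in D) (g1 x (u x) * v x) =
            \int[mu]_(x in D) (h x * u x `^ (b x - 1) * v x)]].
Proof.
have [u [au umin]] := minimizer_exists; have [mu_ u0] := au.
have N0 := minimizer_zero_set au umin.
have mN : measurable (D `&` [set x | u x = 0]).
  rewrite (_ : _ `&` _ = D `&` u @^-1` [set 0])//.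
  by apply: mu_ => //; exact: measurable_set1.
(* Positivity is asked for at every point of [D], so the minimizer is set to 1 on its null zero set,
   and to 0 outside [D]. *)
pose u' x := if x \in D then if u x == 0 then 1 else u x else 0.
have upos x : D x -> 0 < u' x.
  by move=> Dx; rewrite /u' mem_set//; case: ifPn => // ux; rewrite lt0r ux u0.
have au' : adm u'.
  split; last by move=> x Dx; rewrite ltW// upos.
  have meq : measurable_fun D (fun x => u x == 0) by exact: measurable_fun_eqr.
  apply: (@eq_measurable_fun _ _ _ _ D (fun x => if u x == 0 then 1 else u x)).
    by move=> x xD; rewrite /u' xD.
  apply: measurable_fun_if => //; apply: (measurable_funS mD _ mu_).
  by move=> x [].
(* Lower semicontinuity along the constant sequence [u]: a change on a null set does not raise the
   energy, so [u'] is again a minimizer. *)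
have Ju' : (J u' <= J u)%E.
  have -> : J u = limn_einf (fun=> J u).
    by have [->] := cvg_limn_einf_sup (@cvg_cst _ (J u) nat \oo _).
  apply: (J_lsc (fun=> au) au' mN N0) => x Dx Nx.
  rewrite /u' mem_set// ifF; first exact: cvg_cst.
  by apply/eqP => ux; apply: Nx.
have umin' v : adm v -> (J u' <= J v)%E.
  by move=> av; apply: (le_trans Ju'); exact: (umin v av).
have [mu' Au' Bu'] := minimizer_energy au' umin'.
exists u'; split; first by move=> x Dx; rewrite /u' memNset.
split; [exact: mu'|exact: upos|exact: Au'|exact: Bu'|].
move=> v mv Av Bv.
by apply: (positive_minimizer_weak_solution au' umin' upos); split.
Qed.

End singular_problem.

(** * The singular problem on a domain of R^N *)

Lemma singular_growth {R : realType} (b0 b1 h1 M : R) :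
  0 < b0 -> 0 < b1 < 1 -> 0 < h1 -> 0 < M ->
  exists2 C0 : R, 0 <= C0 & forall k b t g : R, 0 <= k <= h1 -> b0 <= b <= b1 ->
    0 <= t -> t <= 1 + M * g -> k / b * t `^ b <= g / 2 + C0.
Proof.
move=> b0_gt0 b1_01 h1_gt0 M_gt0.
have c0 : 0 < h1 / b0 by rewrite divr_gt0.
(* This slope times the bound [h1 / b0] of the coefficient is [1 / (2 M)], so that [t <= 1 + M * g]
   produces exactly [g / 2] and a constant. *)
have e0 : 0 < (2 * M * (h1 / b0))^-1 by rewrite invr_gt0 mulr_gt0// mulr_gt0.
have [C [C_ge0 CP]] := powR_le_lin b1_01 e0.
exists ((2 * M)^-1 + h1 / b0 * C).
  by rewrite addr_ge0// ?mulr_ge0// ?invr_ge0 ltW// mulr_gt0.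
move=> k b t g /andP[k0 kh] /andP[bl bu] t0 tg.
have b_gt0 := lt_le_trans b0_gt0 bl.
have bb : 0 < b <= b1 by rewrite b_gt0.
apply: (@le_trans _ _ (h1 / b0 * ((2 * M * (h1 / b0))^-1 * t + C))).
  apply: ler_pM => //; [by rewrite divr_ge0// ltW|exact: powR_ge0| |exact: CP].
  by apply: ler_pM => //; rewrite ?invr_ge0 ?(ltW b_gt0)// lef_pV2.
have -> : h1 / b0 * ((2 * M * (h1 / b0))^-1 * t + C) = (2 * M)^-1 * t + h1 / b0 * C.
  by field; rewrite !gt_eqF.
rewrite addrA lerD2r.
have -> : g / 2 + (2 * M)^-1 = (2 * M)^-1 * (1 + M * g) by field; rewrite gt_eqF.
by rewrite ler_pM2l// invr_gt0 mulr_gt0.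
Qed.

Lemma closure_compact_rV {R : realType} {N : nat} (A : set 'rV[R]_N) :
  bounded_set A -> compact (closure A).
Proof.
move=> [M [Mr MA]]; apply: bounded_closed_compact; last exact: closed_closure.
exists M; split => // k Mk x clx /=.
have cl : closed [set y : 'rV[R]_N | `|y| <= k].
  rewrite (_ : [set y : 'rV[R]_N | `|y| <= k] = Num.norm @^-1` [set t | t <= k])//.
  by apply: closed_comp (@closed_le _ k) => y _; exact: norm_continuous.
have : closure [set y : 'rV[R]_N | `|y| <= k] x.
  by apply: closure_subset clx => y /(MA k Mk).
by rewrite -((closure_id _).1 cl).
Qed.

Section lebesgue_rV_measurability.
Context {R : realType} {N : nat}.
Local Notation vec := 'rV[R]_N.
Local Notation X := (lebesgue_rV_type R N).

Lemma measurable_enormB (D : set (X * X)) :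
  measurable_fun D (fun z => enorm ((z.1 : vec) - (z.2 : vec))).
Proof.
have mc (i : 'I_N) : measurable_fun setT (fun x : X => (x : vec) 0 i).
  by apply: continuous_measurable_rV; [exact: openT|move=> x _; exact: coord_continuous].
apply: measurable_funTS; apply: (@measurableT_comp _ _ _ _ _ _ (@Num.sqrt R)).
  by apply: continuous_measurable_fun; exact: sqrt_continuous.
apply: measurable_sum => i.
apply: measurable_funX.
rewrite (_ : (fun _ => _) = (fun z : X * X => (z.1 : vec) 0 i - (z.2 : vec) 0 i)); last first.
  by apply/funext => z; rewrite !mxE.
apply: measurable_funB.
  exact: (measurableT_comp (mc i) measurable_fst).
exact: (measurableT_comp (mc i) measurable_snd).
Qed.

Lemma measurable_mu_density (D : set (X * X)) :
  measurable_fun D (fun z => mu_density (z.1 : vec) (z.2 : vec)).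
Proof.
apply: measurable_funV_ge0; first by apply: measurable_funX; exact: measurable_enormB.
by move=> z _; rewrite exprn_ge0// sqrtr_ge0.
Qed.

Lemma measurable_frac_kernel (s : vec * vec -> R) (D : set (X * X)) : continuous s ->
  measurable_fun D (fun z => (enorm ((z.1 : vec) - (z.2 : vec)) `^ s (z.1, z.2))^-1).
Proof.
move=> cs; apply: measurable_funV_ge0; last by move=> z _; exact: powR_ge0.
apply: measurable_fun_powR2; first exact: measurable_enormB.
rewrite (_ : (fun _ => _) = s); last by apply/funext => -[].
apply: measurable_funTS; apply: continuous_measurable_rVX; first exact: openT.
by move=> x _; exact: cs.
Qed.

Lemma measurable_closure_rV (A : set vec) : measurable (closure A : set X).
Proof.
rewrite -[closure A]setCK; apply: measurableC; apply: open_measurable_rV.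
by rewrite openC; exact: closed_closure.
Qed.

End lebesgue_rV_measurability.

Unset Implicit Arguments.

Theorem theorem1p7 (R : realType) (N : nat) (N2 : (2 <= N)%N)
  (Omega : set 'rV[R]_N) (HOmega : bounded_lipschitz_domain Omega)
  (s : 'rV[R]_N * 'rV[R]_N -> R)
  (s_cont : continuous s)
  (s01 : forall z, 0 < s z < 1)
  (s_sym : forall x y, s (x, y) = s (y, x))
  (s_inf : 0 < inf (range s)) (s_sup : sup (range s) < 1)
  (a : 'rV[R]_N -> 'rV[R]_N -> R -> R)
  (a_ge0 : forall x y t, closure Omega x -> closure Omega y -> 0 < t ->
    0 <= a x y t)
  (G_cara : caratheodory_function (closure Omega `*` closure Omega)
    (primitiveG a))
  (a_lim0 : forall x y, closure Omega x -> closure Omega y ->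
    a x y t * t @[t --> 0^'+] --> 0)
  (a_limy : forall x y, closure Omega x -> closure Omega y ->
    a x y t * t @[t --> +oo] --> +oo)
  (a_cont : forall x y, closure Omega x -> closure Omega y ->
    {in `]0, +oo[, continuous (a x y)})
  (a_incr : forall x y, closure Omega x -> closure Omega y ->
    {in `]0, +oo[ &, {homo (fun t => a x y t * t) : t t' / t < t'}})
  (gm gp : R) (gm_gt1 : 1 < gm)
  (G_growth : forall x y t, closure Omega x -> closure Omega y -> 0 < t ->
    gm <= a x y t * t ^+ 2 / primitiveG a x y t <= gp)
  (C1 C2 : R) (C1_gt0 : 0 < C1) (C2_gt0 : 0 < C2)
  (G_at1 : forall x y, closure Omega x -> closure Omega y ->
    C1 <= primitiveG a x y 1 <= C2)
  (M : R) (M_gt0 : 0 < M)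
  (p : 'rV[R]_N * 'rV[R]_N -> R) (pm pp : R)
  (p_cont : {within closure Omega `*` closure Omega, continuous p})
  (p_sym : forall x y, closure Omega x -> closure Omega y ->
    p (x, y) = p (y, x))
  (pm_gt1 : 1 < pm)
  (p_bnd : forall x y, closure Omega x -> closure Omega y ->
    pm <= p (x, y) <= pp)
  (spN : sup (range s) * pp < N%:R)
  (G_ge_pow : forall x y t, closure Omega x -> closure Omega y -> 0 <= t ->
    `|t| `^ p (x, y) <= M * primitiveG a x y t)
  (m : 'rV[R]_N -> R)
  (m_cont : {within closure Omega, continuous m})
  (m01 : forall x, closure Omega x -> 0 < m x < 1)
  (r : 'rV[R]_N -> R)
  (r_cont : {within closure Omega, continuous r})
  (r_bnd : forall x, closure Omega x ->
    1 < r x < N%:R * p (x, x) / (N%:R - s (x, x) * p (x, x)))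
  (h : 'rV[R]_N -> R)
  (h_cont : {within closure Omega, continuous h})
  (h_gt0 : forall x, closure Omega x -> 0 < h x)
  (h_leb : lebesgue_var Omega (fun x => r x / (r x + m x - 1)) h) :
  exists u0 : 'rV[R]_N -> R,
    [/\ weak_solution Omega s a h m u0,
        (forall x, ~ Omega x -> u0 x = 0) &
        ~ {ae lebesgue_rV R N, forall x, Omega x -> u0 x = 0}].
Proof.
have [oO _ O_neq0 bO _] := HOmega.
set X := lebesgue_rV_type R N; set leb := lebesgue_rV R N.
have subO : Omega `<=` closure Omega by exact: subset_closure.
have mO : measurable (Omega : set X) by exact: open_measurable_rV.
have mcl : measurable (closure Omega : set X) by exact: measurable_closure_rV.
have lebO : (leb Omega < +oo)%E by exact: bounded_lebesgue_rV_lty.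
have cpt := closure_compact_rV bO.
have cl_neq0 : closure Omega !=set0 by case: O_neq0 => x /subO; exists x.
(* On the compact closure the extreme values of [h] and [m] are attained, which keeps them strictly
   inside their ranges. *)
have [xh /[!inE] clh hmin] := compact_EVT_min cl_neq0 cpt h_cont.
have [xH /[!inE] clH hmax] := compact_EVT_max cl_neq0 cpt h_cont.
have [xm /[!inE] clm mmin] := compact_EVT_min cl_neq0 cpt m_cont.
have [xM /[!inE] clM mmax] := compact_EVT_max cl_neq0 cpt m_cont.
have /andP[m_gt0 m_lt1] := m01 _ clm; have /andP[M_gt0' M_lt1] := m01 _ clM.
(* The exponent of the primitive of [t^(-m)]; on the closure it is least at [xM] and greatest at
   [xm]. *)
pose b x := 1 - m x.
have b_bnd x : Omega x -> b xM <= b x <= b xm.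
  move=> /subO Ox; rewrite /b !lerD2l !lerN2.
  by rewrite mmin ?mmax// inE.
have b0_gt0 : 0 < b xM by rewrite subr_gt0.
have b1_lt1 : b xm < 1 by rewrite ltrBlDr ltrDl.
have b1_gt0 : 0 < b xm by rewrite subr_gt0.
have h_bnd x : Omega x -> 0 <= h x <= h xH.
  move=> /subO Ox; rewrite (ltW (h_gt0 _ Ox))/=.
  by rewrite hmax// inE.
have b1_01 : 0 < b xm < 1 by rewrite b1_gt0.
have [C0 C0_ge0 C0P] := singular_growth b0_gt0 b1_01 (h_gt0 _ clH) M_gt0.
pose K : R := 2 ^+ Num.bound (2 * gp).
have K0 : 0 <= K by rewrite exprn_ge0.
pose gam x y (t : R) := a x y `|t| * t.
have Y x y : closure Omega x -> closure Omega y ->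
    young_pair K (primitiveG a x y) (gam x y).
  move=> clx cly; apply: (@young_of_density R (a x y) gm gp) => //.
  - by move=> t; exact: a_ge0.
  - exact: a_lim0.
  - exact: a_cont.
  - exact: a_incr.
  - by move=> t; exact: G_growth.
have Y1 x : Omega x -> young_pair K (primitiveG a x x) (gam x x).
  by move=> /subO clx; exact: Y.
have Y2 (z : X * X) : ((Omega : set X) `*` (Omega : set X)) z ->
    young_pair K (primitiveG a z.1 z.2) (gam z.1 z.2).
  by move=> [/subO ? /subO ?]; exact: Y.
have mclX : measurable ((closure Omega : set X) `*` (closure Omega : set X)).
  exact: measurableX.
have mG2 t : measurable_fun ((Omega : set X) `*` (Omega : set X))
    (fun z : X * X => primitiveG a z.1 z.2 t).
  apply: (measurable_funS mclX _ (G_cara.1 t)).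
  by move=> z [/subO ? /subO ?].
have mG1 t : measurable_fun (Omega : set X) (fun x : X => primitiveG a x x t).
  apply: (measurable_comp mclX _ (G_cara.1 t) (g := fun x : X => (x, x))).
    by move=> _ [x /subO clx <-].
  by apply: measurable_funTS; exact: measurable_fun_pair.
have mh : measurable_fun (Omega : set X) (h : X -> R) by case: h_leb.
have mb : measurable_fun (Omega : set X) (b : X -> R).
  apply: measurable_funB => //; apply: continuous_measurable_rV => //.
  exact: continuous_at_within_closure.
have h_ge x : Omega x -> h xh <= h x by move=> /subO Ox; rewrite hmin ?inE.
have G_at1' x : Omega x -> primitiveG a x x 1 <= C2.
  by move=> /subO Ox; have /andP[] := G_at1 _ _ Ox Ox.
(* For [t >= 1] the power bound applies, since [t <= t^p]; for [t <= 1] the constant 1 suffices. *)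
have G_lin x t : Omega x -> 0 <= t -> t <= 1 + M * primitiveG a x x t.
  move=> Ox t0; have clx := subO _ Ox.
  have G0 : 0 <= M * primitiveG a x x t by rewrite mulr_ge0 ?(ltW M_gt0)// (young_ge0 (Y1 _ Ox)).
  have [t1|/ltW t1] := leP t 1; first by rewrite (le_trans t1)// lerDl.
  apply: (@le_trans _ _ (M * primitiveG a x x t)); last by rewrite lerDr.
  apply: le_trans (G_ge_pow _ _ _ clx clx t0); rewrite ger0_norm// le1r_powR//.
  by have /andP[pl _] := p_bnd _ _ clx clx; rewrite (le_trans _ pl) ?ltW.
have H_le x t : Omega x -> 0 <= t ->
    h x / b x * t `^ b x <= primitiveG a x x t / 2 + C0.
  by move=> Ox t0; apply: C0P => //; [exact: h_bnd|exact: b_bnd|exact: G_lin].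
have dens0 (z : X * X) : ((Omega : set X) `*` (Omega : set X)) z ->
    0 <= mu_density (z.1 : 'rV[R]_N) (z.2 : 'rV[R]_N).
  by move=> _; rewrite invr_ge0 exprn_ge0// sqrtr_ge0.
pose kap (z : X * X) := (enorm ((z.1 : 'rV[R]_N) - (z.2 : 'rV[R]_N)) `^ s (z.1, z.2))^-1.
pose w (z : X * X) := mu_density (z.1 : 'rV[R]_N) (z.2 : 'rV[R]_N).
have mkap : measurable_fun ((Omega : set X) `*` (Omega : set X)) kap.
  exact: measurable_frac_kernel.
have mw : measurable_fun ((Omega : set X) `*` (Omega : set X)) w.
  exact: measurable_mu_density.
have [u [u_out [mu_ u_gt0 Au Bu uP]]] := singular_weak_solution
  mO lebO K0 Y1 mG1 Y2 mG2 mkap mw dens0 mh mb (h_gt0 _ clh) b0_gt0 b1_lt1 h_ge b_bnd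
  M_gt0 C0_ge0 G_at1' G_lin H_le.
(* The space is defined with [|v|] and the modular with [v]; evenness of the Young function
   identifies the two. *)
have hatE (v : 'rV[R]_N -> R) : modular_hat Omega (primitiveG a) v =
    young_modular leb Omega (fun x => primitiveG a x x) (cst 1) v.
  by apply: eq_integral => x; rewrite inE => Ox; rewrite mulr1 (young_norm (Y1 _ Ox)).
have fracE (l : R) (v : 'rV[R]_N -> R) :
    modular_frac Omega s (primitiveG a) (fun x => l * v x) =
    young_modular (leb \x leb)%E ((Omega : set X) `*` (Omega : set X))
      (fun z => primitiveG a z.1 z.2) w (fun z => l * ((v z.1 - v z.2) * kap z)).
  by apply: eq_integral => z _; rewrite /frac_quot -mulrBr mulrA.
have mOO : measurable ((Omega : set X) `*` (Omega : set X)) by exact: measurableX.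
have md v : measurable_fun (Omega : set X) (v : X -> R) ->
    measurable_fun ((Omega : set X) `*` (Omega : set X))
      (fun z : X * X => (v z.1 - v z.2) * kap z).
  move=> mv; apply: measurable_funM => //; apply: measurable_funB.
    apply: (measurable_comp (F := (Omega : set X))) => //; first by move=> _ [z [? ?] <-].
    exact: measurable_funTS.
  apply: (measurable_comp (F := (Omega : set X))) => //; first by move=> _ [z [? ?] <-].
  exact: measurable_funTS.
have mc1 : measurable_fun (Omega : set X) (cst 1 : X -> R) by exact: measurable_cst.
have c10 x : Omega x -> 0 <= (cst 1 : X -> R) x by [].
exists u; split => //; last first.
  (* A null set off which [u] vanishes would contain [Omega], which is open and nonempty and so has
     positive measure. *)
  move=> [A [mA A0 Asub]].
  have : (leb Omega <= leb A)%E.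
    apply: le_measure; rewrite ?inE// => x Ox; apply: Asub => /= /(_ Ox).
    by apply/eqP; rewrite gt_eqF// u_gt0.
  by rewrite A0 leNgt open_lebesgue_rV_gt0.
split; [|exact: u_gt0|].
  split; last first.
    exists 1; first exact: ltr01.
    rewrite fracE; have -> : (fun z : X * X => 1 * ((u z.1 - u z.2) * kap z)) =
        (fun z => (u z.1 - u z.2) * kap z) by apply/funext => z; rewrite mul1r.
    exact: Bu.
  split; first exact: mu_.
  exists 1; first exact: ltr01.
  rewrite hatE; have -> : (fun x => 1 * u x) = u by apply/funext => x; rewrite mul1r.
  exact: Au.
move=> v [[mv [l l0 vl]] [l' l'0 vl']].
(* Membership in the space gives finiteness for some scaling of [v]; doubling removes the
   scaling. *)
have Av : (young_modular leb Omega (fun x => primitiveG a x x) (cst 1%R) v < +oo)%E.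
  move: vl; rewrite hatE.
  exact: (young_modular_scale_ltyP mO K0 Y1 mG1 c10 mc1 (lt0r_neq0 l0) mv).
have Bv : (young_modular (leb \x leb) ((Omega : set X) `*` (Omega : set X))
    (fun z => primitiveG a z.1 z.2) w (fun z => ((v z.1 - v z.2) * kap z)%R) < +oo)%E.
  move: vl'; rewrite fracE.
  exact: (young_modular_scale_ltyP mOO K0 Y2 mG2 dens0 mw (lt0r_neq0 l'0) (md _ mv)).
have [i1 i2 i3 eqn] := uP v mv Av Bv.
have f3E : (fun x => h x / u x `^ m x * v x) = (fun x => h x * u x `^ (b x - 1) * v x).
  apply/funext => x; rewrite -powRN; congr (_ * _ `^ _ * _); rewrite /b; ring.
move=> Dv f1 f2 f3 O; rewrite /f3 f3E.
by split; [exact: i1|exact: i2|exact: i3|exact: eqn].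
Qed.
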